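(* Let $u:\mathbb{R}\times\mathbb{R}\to\mathbb{R}$, $(q,t)\mapsto u(q,t)$, be a function of class $C^2$ with $u(q+1,t)=u(q,t)$ for all $q,t$, such that there is a constant $K>0$ with $\int_0^1 u_q(q,t)^2\,dq<K$ for all $t\in\mathbb{R}$. Put $F(q,t)=u_q(q,t)$ and assume that $F$ is not identically zero. Let $\varphi:\mathbb{R}\times\mathbb{R}\to\mathbb{R}$, $(\alpha,q)\mapsto\varphi(\alpha,q)$, be any foliated initial data, i.e. a $C^2$ function such that $\varphi(\alpha,q)$ is $1$-periodic in $q$ for every $\alpha$, and such that for every fixed $q$ the map $\alpha\mapsto\varphi(\alpha,q)$ is a $C^2$-diffeomorphism of $\mathbb{R}$. Then there exists a value of $\alpha$ such that the solution $f_\alpha$ of the forced inviscid Burgers equation $$f_t+f f_q+F=0,\qquad f_\alpha(q,0)=\varphi(\alpha,q),$$ develops a shock singularity in a finite (positive or negative) time.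
   Context: Subscripts $q,t$ denote partial derivatives. For a fixed $\alpha$, the solution $f_\alpha(q,t)$ is the classical ($C^1$) solution, $1$-periodic in $q$, with $f_\alpha(q,0)=\varphi(\alpha,q)$; it is considered both forward and backward in time and is constructed by the method of characteristics, the characteristics being the solutions of $\dot q=p$, $\dot p=-u_q(q,t)$ with $q(0)=q_0$, $p(0)=\varphi(\alpha,q_0)$. Saying that $f_\alpha$ develops a shock in a finite positive or negative time means that the classical solution does not exist for all $t\in\mathbb{R}$, i.e. there is no classical $C^1$ solution on all of $\mathbb{R}\times\mathbb{R}$, $1$-periodic in $q$, with this initial condition. *)

(* Defs.v *)
(* Real analysis over Stdlib's R with Coquelicot. *)
From Stdlib Require Import Reals.
From Coquelicot Require Import Coquelicot.
Open Scope R_scope.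

(* [ex_diff_n g n x y] asks, at (x, y), for continuity of g and existence and
   continuity of all its partial derivatives up to order n; over the whole
   plane this is class C^n. *)
Definition class_C_2d (n : nat) (g : R -> R -> R) : Prop :=
  forall x y : R, ex_diff_n g n x y.

(* All orders k <= n are listed because [ex_derive_n h n x] alone says nothing
   about the differentiability of the lower-order derivatives. *)
Definition class_C (n : nat) (h : R -> R) : Prop :=
  forall (k : nat) (x : R), (k <= n)%nat ->
    ex_derive_n h k x /\ continuous (Derive_n h k) x.

Definition C2_diffeomorphism (h : R -> R) : Prop :=
  class_C 2 h /\
  exists k : R -> R,
    class_C 2 k /\ (forall x : R, k (h x) = x) /\ (forall y : R, h (k y) = y).

Definition partial1 (g : R -> R -> R) (x y : R) : R := Derive (fun s => g s y) x.
Definition partial2 (g : R -> R -> R) (x y : R) : R := Derive (fun s => g x s) y.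

(* The arguments of [phi] are (alpha, q), in this order. *)
Definition foliated_initial_data (phi : R -> R -> R) : Prop :=
  class_C_2d 2 phi /\
  (forall alpha q : R, phi alpha (q + 1) = phi alpha q) /\
  (forall q : R, C2_diffeomorphism (fun alpha => phi alpha q)).

(* The arguments of [F] and [f] are (q, t), in this order; t ranges over all of
   R, both forward and backward in time. *)
Definition global_classical_solution
    (F : R -> R -> R) (g : R -> R) (f : R -> R -> R) : Prop :=
  class_C_2d 1 f /\
  (forall q t : R, f (q + 1) t = f q t) /\
  (forall q t : R, partial2 f q t + f q t * partial1 f q t + F q t = 0) /\
  (forall q : R, f q 0 = g q).

(* The classical solution with initial condition [g] breaks down at a finite
   positive or negative time, i.e. it does not exist for all t. *)
Definition develops_shock (F : R -> R -> R) (g : R -> R) : Prop :=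
  ~ exists f : R -> R -> R, global_classical_solution F g f.

(* Main.v *)
Require Import Defs.
From Stdlib Require Import Reals ZArith Lra Lia Psatz ClassicalEpsilon.
From Coquelicot Require Import Coquelicot.
Open Scope R_scope.

(** Suppose that every initial condition [phi alpha] has a global solution. Since
    [alpha |-> phi alpha q] is onto, every point (q, p) of the phase plane lies
    at time 0 on the graph of some global solution f, and it suffices to show that the force
    F = u_q then vanishes identically ([global_solutions_zero_force]).

    A global solution calibrates the action A(x) = int x'^2/2 - u(x,t) dt.
    If S(.,t) is a primitive of f(.,t), the Burgers equation gives
    S_t = -(f^2/2 + u) + h(t), so that for every path A(x) is the increment of
    S, minus int h, plus int (x' - f(x,t))^2/2. Hence the characteristics x' = f(x,t) minimize the
    action among all paths with the same endpoints, and for a perturbation xi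
    vanishing at the endpoints
      int xi'^2/2 - (u(x+xi,t) - u(x,t) - F(x,t) xi) dt >= 0.

    This inequality, with xi = xi(q,p,t) a function on the extended phase space of
    compact support in p and t, is averaged over all orbits. The flow of
    q' = p, p' = -F preserves area, so the average becomes an integral over
    (q,p,t). If xi = g(p,t) does not depend on q, the potential part averages
    to zero, because u has period 1 and F has mean zero. The kinetic part
    is the integral of (g_t - F g_p)^2/2, which the bound on the mean of
    F^2 controls by the Dirichlet energy of g in the (p,t) plane. A plane
    logarithmic cutoff makes this energy arbitrarily small while g = c on a given disc.
    If F is not zero, some translate F(q+c,t) differs from F(q,t). The
    correction xi = g + s (F(q+c,t) - F(q,t)) psi, with psi a bump supported
    where g = c, changes the average by -s int (F(q+c,t) - F(q,t))^2 psi + O(s^2),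
    which makes it negative for small s, a contradiction.

    No flow is constructed: orbits are replaced by those of the symplectic Euler
    scheme x_(n+1) = x_n + tau p_n, p_(n+1) = p_n - tau F(x_(n+1), t_(n+1)).
    Each of its steps is a composition of two shears, so it preserves area
    exactly, by periodicity, translation invariance and exchange of integrals
    ([phase_integral_euler_step]). The calibration inequality holds for it up to
    an error that tends to 0 with tau, uniformly on bounded sets of momenta, by
    compactness ([total_variation_lower]). This yields the lower bound
    [mean_variation_lower], which contradicts [mean_variation_upper]. *)

(** * Continuous functions of two variables *)

(** Joint continuity on the whole plane. *)
Definition continuous2 (g : R -> R -> R) : Prop :=
  forall x y, continuity_2d_pt g x y.

(** Period 1 in the first variable. *)
Definition periodic1 (g : R -> R -> R) : Prop :=
  forall x y, g (x + 1) y = g x y.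

Lemma continuous2_pair (g : R -> R -> R) (x y : R) :
  continuous2 g -> continuous (fun z : R * R => g (fst z) (snd z)) (x, y).
Proof. intros H. apply continuity_2d_pt_filterlim, H. Qed.

Lemma continuous2_comp (g a b : R -> R -> R) :
  continuous2 g -> continuous2 a -> continuous2 b ->
  continuous2 (fun x y => g (a x y) (b x y)).
Proof.
  intros Hg Ha Hb x y. apply continuity_2d_pt_filterlim.
  apply (continuous_comp_2 (fun z : R * R => a (fst z) (snd z))
           (fun z : R * R => b (fst z) (snd z)) g (x, y));
    now apply continuous2_pair.
Qed.

Lemma continuous2_const (c : R) : continuous2 (fun _ _ => c).
Proof. intros x y. apply continuity_2d_pt_const. Qed.

Lemma continuous2_fst : continuous2 (fun x _ => x).
Proof. intros x y. apply continuity_2d_pt_id1. Qed.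

Lemma continuous2_snd : continuous2 (fun _ y => y).
Proof. intros x y. apply continuity_2d_pt_id2. Qed.

Lemma continuous2_plus (a b : R -> R -> R) :
  continuous2 a -> continuous2 b -> continuous2 (fun x y => a x y + b x y).
Proof. intros Ha Hb x y. now apply continuity_2d_pt_plus. Qed.

Lemma continuous2_minus (a b : R -> R -> R) :
  continuous2 a -> continuous2 b -> continuous2 (fun x y => a x y - b x y).
Proof. intros Ha Hb x y. now apply continuity_2d_pt_minus. Qed.

Lemma continuous2_mult (a b : R -> R -> R) :
  continuous2 a -> continuous2 b -> continuous2 (fun x y => a x y * b x y).
Proof. intros Ha Hb x y. now apply continuity_2d_pt_mult. Qed.

Lemma continuous2_pow (a : R -> R -> R) (n : nat) :
  continuous2 a -> continuous2 (fun x y => a x y ^ n).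
Proof.
  intros Ha; induction n as [|n IH]; simpl;
    [apply continuous2_const | now apply continuous2_mult].
Qed.

Lemma continuous2_swap (g : R -> R -> R) :
  continuous2 g -> continuous2 (fun x y => g y x).
Proof.
  intros H. apply (continuous2_comp g);
    [exact H | apply continuous2_snd | apply continuous2_fst].
Qed.

Lemma continuous2_1 (g : R -> R -> R) (y : R) :
  continuous2 g -> forall x, continuous (fun x => g x y) x.
Proof.
  intros H x.
  apply (continuous_comp_2 (fun x => x) (fun _ => y) g x);
    [apply continuous_id | apply continuous_const | now apply continuous2_pair].
Qed.

Lemma continuous2_2 (g : R -> R -> R) (x : R) :
  continuous2 g -> forall y, continuous (fun y => g x y) y.
Proof.
  intros H y.
  apply (continuous_comp_2 (fun _ => x) (fun y => y) g y);
    [apply continuous_const | apply continuous_id | now apply continuous2_pair].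
Qed.

Lemma ex_RInt_1 (g : R -> R -> R) (y a b : R) :
  continuous2 g -> ex_RInt (fun x => g x y) a b.
Proof.
  intros H. apply (ex_RInt_continuous (V := R_CompleteNormedModule)).
  intros; now apply continuous2_1.
Qed.

Lemma ex_RInt_2 (g : R -> R -> R) (x a b : R) :
  continuous2 g -> ex_RInt (fun y => g x y) a b.
Proof.
  intros H. apply (ex_RInt_continuous (V := R_CompleteNormedModule)).
  intros; now apply continuous2_2.
Qed.

(** ** Periodicity and compactness: uniform estimates on strips *)

Lemma periodic1_Z (g : R -> R -> R) (k : Z) (x y : R) :
  periodic1 g -> g (x + IZR k) y = g x y.
Proof.
  intros H.
  assert (Hn : forall n x, g (x + INR n) y = g x y).
  { induction n as [|n IH]; intros z.
    - simpl; f_equal; ring.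
    - rewrite S_INR. replace (z + (INR n + 1)) with ((z + INR n) + 1) by ring.
      rewrite H; apply IH. }
  destruct (Z_le_gt_dec 0 k) as [Hk|Hk].
  - rewrite <- (Z2Nat.id k) by lia. rewrite <- INR_IZR_INZ. apply Hn.
  - replace k with (- Z.of_nat (Z.to_nat (- k)))%Z by lia.
    rewrite opp_IZR, <- INR_IZR_INZ.
    rewrite <- (Hn (Z.to_nat (-k)) (x + - INR (Z.to_nat (- k)))).
    f_equal; ring.
Qed.

Lemma shift_to_unit (x : R) : exists k : Z, 0 <= x + IZR k < 1.
Proof.
  destruct (floor_ex x) as [k Hk]. exists (- k)%Z. rewrite opp_IZR. lra.
Qed.

Lemma strip_uniform (g : R -> R -> R) (T e : R) :
  continuous2 g -> periodic1 g -> 0 < e ->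
  exists d, 0 < d /\ forall x y t s, Rabs t <= T -> Rabs s <= T ->
    Rabs (y - x) < d -> Rabs (s - t) < d -> Rabs (g y s - g x t) < e.
Proof.
  intros Hc Hp He.
  destruct (uniform_continuity_2d g (-1) 2 (- T) T (fun x y _ _ => Hc x y)
              (mkposreal e He)) as [d Hd].
  exists (Rmin d 1). split. { apply Rmin_pos; [apply cond_pos|lra]. }
  intros x y t s Ht Hs Hxy Hts.
  apply Rabs_le_between in Ht. apply Rabs_le_between in Hs.
  assert (H1 : Rabs (y - x) < d) by (eapply Rlt_le_trans; [apply Hxy|apply Rmin_l]).
  assert (H2 : Rabs (y - x) < 1) by (eapply Rlt_le_trans; [apply Hxy|apply Rmin_r]).
  assert (H3 : Rabs (s - t) < d) by (eapply Rlt_le_trans; [apply Hts|apply Rmin_l]).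
  destruct (shift_to_unit x) as [k Hk].
  rewrite <- (periodic1_Z g k x t Hp), <- (periodic1_Z g k y s Hp).
  apply Rabs_lt_between in H2.
  apply Hd; try lra.
  replace (y + IZR k - (x + IZR k)) with (y - x) by ring. exact H1.
Qed.

Lemma strip_bounded (g : R -> R -> R) (T : R) :
  continuous2 g -> periodic1 g ->
  exists B, 0 < B /\ forall x t, Rabs t <= T -> Rabs (g x t) <= B.
Proof.
  intros Hc Hp.
  (* the radius is also at most [1 / (1 + |g|)], so that the lower bound on radii given by
     compactness bounds [g] *)
  assert (Hex : forall z : R * R, exists d : posreal,
    d <= / (1 + Rabs (g (fst z) (snd z))) /\
    forall x y, Rabs (x - fst z) < d -> Rabs (y - snd z) < d ->
      Rabs (g x y - g (fst z) (snd z)) < 1).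
  { intros [u v]; simpl. destruct (Hc u v (mkposreal 1 Rlt_0_1)) as [d Hd].
    assert (Hpos : 0 < / (1 + Rabs (g u v))).
    { apply Rinv_0_lt_compat. generalize (Rabs_pos (g u v)); lra. }
    exists (mkposreal _ (Rmin_pos _ _ (cond_pos d) Hpos)). simpl. split.
    - apply Rmin_r.
    - intros x y Hx Hy. apply Hd; eapply Rlt_le_trans; eauto; apply Rmin_l. }
  apply choice in Hex. destruct Hex as [dl Hdl].
  destruct (compactness_value_2d 0 1 (- T) T (fun u v => dl (u, v))) as [d Hd].
  exists (/ d + 1). split.
  { generalize (Rinv_0_lt_compat d (cond_pos d)); lra. }
  intros x t Ht. apply Rabs_le_between in Ht.
  destruct (shift_to_unit x) as [k Hk].
  rewrite <- (periodic1_Z g k x t Hp).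
  apply Rnot_lt_le. intros Hlt. apply (Hd (x + IZR k) t); try lra.
  intros [u [v [Hu [Hv [Hxu [Htv Hduv]]]]]].
  destruct (Hdl (u, v)) as [H1 H2]; simpl in *.
  specialize (H2 _ _ Hxu Htv).
  assert (H3 : 1 + Rabs (g u v) <= / d).
  { apply (Rle_trans _ _ _ Hduv) in H1.
    rewrite <- (Rinv_inv (1 + Rabs (g u v))).
    apply Rinv_le_contravar; [apply cond_pos | exact H1]. }
  assert (H4 := Rabs_triang_inv (g (x + IZR k) t) (g u v)). lra.
Qed.

(** ** Functions of class C1 *)

Lemma C1_continuous (g : R -> R -> R) : class_C_2d 1 g -> continuous2 g.
Proof. intros H x y. apply (H x y). Qed.

Lemma C1_partial1 (g : R -> R -> R) : class_C_2d 1 g -> continuous2 (partial1 g).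
Proof. intros H x y. apply (H x y). Qed.

Lemma C1_partial2 (g : R -> R -> R) : class_C_2d 1 g -> continuous2 (partial2 g).
Proof. intros H x y. apply (H x y). Qed.

Lemma C1_derive1 (g : R -> R -> R) (x y : R) :
  class_C_2d 1 g -> is_derive (fun z => g z y) x (partial1 g x y).
Proof. intros H. apply Derive_correct. apply (H x y). Qed.

Lemma C1_derive2 (g : R -> R -> R) (x y : R) :
  class_C_2d 1 g -> is_derive (fun z => g x z) y (partial2 g x y).
Proof. intros H. apply Derive_correct. apply (H x y). Qed.

Lemma C2_C1 (g : R -> R -> R) : class_C_2d 2 g -> class_C_2d 1 g.
Proof.
  intros H x y. destruct (H x y) as [H0 [H1 [H2 [H3 H4]]]].
  simpl in *. tauto.
Qed.

Lemma C2_partial1_C1 (g : R -> R -> R) : class_C_2d 2 g -> class_C_2d 1 (partial1 g).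
Proof. intros H x y. apply (H x y). Qed.

Lemma periodic_partial1 (g : R -> R -> R) : periodic1 g -> periodic1 (partial1 g).
Proof.
  intros H x y. unfold partial1.
  rewrite <- (Derive_ext (fun s => g (s + 1) y) (fun s => g s y) x) by (intros; apply H).
  unfold Derive. f_equal. apply Lim_ext. intros h.
  replace (x + 1 + h) with (x + h + 1) by ring. reflexivity.
Qed.

Lemma periodic_partial2 (g : R -> R -> R) : periodic1 g -> periodic1 (partial2 g).
Proof. intros H x y. unfold partial2. apply Derive_ext. intros; apply H. Qed.

Lemma MVT_derive (h dh : R -> R) (a b : R) :
  (forall x, is_derive h x (dh x)) ->
  exists c, Rmin a b <= c <= Rmax a b /\ h b - h a = dh c * (b - a).
Proof.
  intros H. apply MVT_gen; intros x _; [apply H|].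
  apply continuity_pt_filterlim.
  exact (ex_derive_continuous h x (ex_intro _ _ (H x))).
Qed.

Lemma between_dist (a b c : R) :
  Rmin a b <= c <= Rmax a b -> Rabs (c - a) <= Rabs (b - a).
Proof.
  unfold Rmin, Rmax. destruct (Rle_dec a b); intros H;
    unfold Rabs; repeat destruct Rcase_abs; lra.
Qed.

Lemma between_strip (a b c T : R) :
  Rmin a b <= c <= Rmax a b -> Rabs a <= T -> Rabs b <= T -> Rabs c <= T.
Proof.
  unfold Rmin, Rmax. intros H Ha Hb.
  apply Rabs_le_between in Ha; apply Rabs_le_between in Hb; apply Rabs_le_between.
  destruct (Rle_dec a b); lra.
Qed.

Lemma strip_lipschitz (g : R -> R -> R) (T : R) :
  class_C_2d 1 g -> periodic1 g ->
  exists L, 0 < L /\ forall x y t s, Rabs t <= T -> Rabs s <= T ->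
    Rabs (g y s - g x t) <= L * (Rabs (y - x) + Rabs (s - t)).
Proof.
  intros Hg Hp.
  destruct (strip_bounded _ T (C1_partial1 g Hg) (periodic_partial1 g Hp)) as [A [HA HA']].
  destruct (strip_bounded _ T (C1_partial2 g Hg) (periodic_partial2 g Hp)) as [B [HB HB']].
  exists (A + B). split; [lra|]. intros x y t s Ht Hs.
  destruct (MVT_derive (fun z => g z s) (fun z => partial1 g z s) x y) as [c [Hc Ec]].
  { intros; now apply C1_derive1. }
  destruct (MVT_derive (fun z => g x z) (fun z => partial2 g x z) t s) as [c' [Hc' Ec']].
  { intros; now apply C1_derive2. }
  replace (g y s - g x t) with (partial1 g c s * (y - x) + partial2 g x c' * (s - t)) by lra.
  eapply Rle_trans; [apply Rabs_triang|]. rewrite !Rabs_mult.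
  specialize (HA' c s Hs). specialize (HB' x c' (between_strip _ _ _ _ Hc' Ht Hs)).
  generalize (Rabs_pos (y - x)) (Rabs_pos (s - t)); intros.
  nra.
Qed.

(** * Finite sums *)

(** The sum of [a k] over [k < n]; it has [n] terms. *)
Fixpoint sum_below (a : nat -> R) (n : nat) : R :=
  match n with
  | O => 0
  | S k => sum_below a k + a k
  end.

Lemma sum_below_le (a b : nat -> R) (n : nat) :
  (forall k, (k < n)%nat -> a k <= b k) -> sum_below a n <= sum_below b n.
Proof.
  induction n as [|n IH]; simpl; intros H; [lra|].
  apply Rplus_le_compat; [apply IH; intros; apply H; lia | apply H; lia].
Qed.

Lemma sum_below_ext (a b : nat -> R) (n : nat) :
  (forall k, (k < n)%nat -> a k = b k) -> sum_below a n = sum_below b n.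
Proof.
  induction n as [|n IH]; simpl; intros H; [reflexivity|].
  rewrite IH by (intros; apply H; lia). rewrite H by lia. reflexivity.
Qed.

Lemma sum_below_plus (a b : nat -> R) (n : nat) :
  sum_below (fun k => a k + b k) n = sum_below a n + sum_below b n.
Proof. induction n as [|n IH]; simpl; [ring|rewrite IH; ring]. Qed.

Lemma sum_below_scal (c : R) (a : nat -> R) (n : nat) :
  sum_below (fun k => c * a k) n = c * sum_below a n.
Proof. induction n as [|n IH]; simpl; [ring|rewrite IH; ring]. Qed.

Lemma sum_below_telescope (a : nat -> R) (n : nat) :
  sum_below (fun k => a (S k) - a k) n = a n - a O.
Proof. induction n as [|n IH]; simpl; [ring|rewrite IH; ring]. Qed.

Lemma sum_below_const (c : R) (n : nat) : sum_below (fun _ => c) n = INR n * c.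
Proof.
  induction n as [|n IH]; [simpl; ring|].
  rewrite S_INR; cbn [sum_below]; rewrite IH; ring.
Qed.

(** * Discrete time *)

(** The grid of step [tau] starting at [- T]. With [N tau = T], index [N] is time 0 and
    index [2 N] is time [T]. *)
Definition time (T tau : R) (n : nat) : R := INR n * tau - T.

Lemma time_S (T tau : R) (n : nat) : time T tau (S n) = time T tau n + tau.
Proof. unfold time. rewrite S_INR. ring. Qed.

Lemma time_0 (T tau : R) : time T tau 0 = - T.
Proof. unfold time; simpl; ring. Qed.

Lemma time_mid (T tau : R) (N : nat) : INR N * tau = T -> time T tau N = 0.
Proof. unfold time; intros ->; ring. Qed.

Lemma time_end (T tau : R) (N : nat) : INR N * tau = T -> time T tau (2 * N) = T.
Proof. intros H. unfold time. rewrite mult_INR. simpl (INR 2). lra. Qed.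

Lemma time_bound (T tau : R) (N n : nat) :
  0 < tau -> INR N * tau = T -> (n <= 2 * N)%nat -> Rabs (time T tau n) <= T.
Proof.
  intros Ht HN Hn. apply le_INR in Hn. rewrite mult_INR in Hn. simpl (INR 2) in Hn.
  assert (0 <= INR n) by apply pos_INR.
  unfold time. apply Rabs_le_between.
  assert (INR n * tau <= (1 + 1) * INR N * tau) by (apply Rmult_le_compat_r; lra).
  assert (0 <= INR n * tau) by (apply Rmult_le_pos; lra). lra.
Qed.

(** Discrete Gronwall estimate. The weight [1 + M tau] also multiplies the
    inhomogeneous term, so the same form serves both time directions. *)
Lemma discrete_gronwall (M tau c : R) (y : nat -> R) (m : nat) :
  0 <= M -> 0 < tau -> 0 <= c -> (forall k, 0 <= y k) ->
  (forall k, (k < m)%nat -> y (S k) <= (1 + M * tau) * (y k + tau * c)) ->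
  forall k, (k <= m)%nat ->
    y k <= exp (M * (INR k * tau)) * (y O + INR k * tau * c).
Proof.
  intros HM Ht Hc Hy H k. induction k as [|k IH]; intros Hk.
  - simpl. replace (M * (0 * tau)) with 0 by ring. rewrite exp_0. lra.
  - specialize (IH ltac:(lia)). specialize (H k ltac:(lia)).
    rewrite S_INR.
    replace (M * ((INR k + 1) * tau)) with (M * (INR k * tau) + M * tau) by ring.
    rewrite exp_plus.
    assert (Hx : 0 <= M * (INR k * tau)).
    { apply Rmult_le_pos; [lra|apply Rmult_le_pos; [apply pos_INR|lra]]. }
    assert (HE : 1 <= exp (M * (INR k * tau))).
    { eapply Rle_trans; [|apply exp_ineq1_le]. lra. }
    assert (HMt : 0 <= M * tau) by (apply Rmult_le_pos; lra).
    assert (HE' := exp_ineq1_le (M * tau)).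
    set (E := exp (M * (INR k * tau))) in *. set (E' := exp (M * tau)) in *.
    assert (Htc : 0 <= tau * c) by (apply Rmult_le_pos; lra).
    assert (0 <= INR k * tau * c).
    { rewrite Rmult_assoc. apply Rmult_le_pos; [apply pos_INR|lra]. }
    specialize (Hy O) as Hy0.
    assert (y k + tau * c <= E * (y O + (INR k + 1) * tau * c)) by nra.
    assert (0 <= E * (y O + (INR k + 1) * tau * c)) by nra.
    assert (0 <= y k + tau * c) by (specialize (Hy k); lra).
    nra.
Qed.

(** * Calibration by a global solution *)

(** A generating function of the graph of [f(., t)]. When [f] solves the Burgers
    equation it satisfies the Hamilton-Jacobi equation up to a function of
    time alone; see [primitive_derive2]. *)
Definition primitive (f : R -> R -> R) (q t : R) : R := RInt (fun s => f s t) 0 q.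

(** Kinetic plus potential energy along the graph of [f]. *)
Definition energy (u f : R -> R -> R) (q t : R) : R := f q t ^ 2 / 2 + u q t.

Lemma primitive_derive1 (f : R -> R -> R) (q t : R) :
  continuous2 f -> is_derive (fun q => primitive f q t) q (f q t).
Proof.
  intros H. apply (is_derive_RInt (fun s => f s t) _ 0).
  - apply filter_forall. intros b. apply (RInt_correct (V := R_CompleteNormedModule)).
    now apply ex_RInt_1.
  - now apply continuous2_1.
Qed.

Lemma continuous2_energy (u f : R -> R -> R) :
  continuous2 u -> continuous2 f -> continuous2 (energy u f).
Proof.
  intros Hu Hf. apply continuous2_plus; [|exact Hu].
  apply (continuous2_mult (fun x y => f x y ^ 2) (fun _ _ => / 2));
    [now apply continuous2_pow | apply continuous2_const].
Qed.

Lemma primitive_derive2 (u f : R -> R -> R) (g : R -> R) (q t : R) :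
  class_C_2d 1 u -> global_classical_solution (partial1 u) g f ->
  is_derive (fun t => primitive f q t) t (energy u f 0 t - energy u f q t).
Proof.
  intros Hu [Hf [_ [Heq _]]].
  assert (Hint : RInt (fun s => partial2 f s t) 0 q = energy u f 0 t - energy u f q t).
  { (* by the Burgers equation, [f_t] is the space derivative of minus the energy *)
    replace (energy u f 0 t - energy u f q t)
      with (minus (- energy u f q t) (- energy u f 0 t))
      by (unfold minus, plus, opp; simpl; ring).
    apply is_RInt_unique.
    apply (is_RInt_derive (V := R_CompleteNormedModule) (fun s => - energy u f s t)
      (fun s => partial2 f s t)).
    - intros x _. replace (partial2 f x t)
        with (- (f x t * partial1 f x t + partial1 u x t)) by (generalize (Heq x t); lra).
      assert (D1 := C1_derive1 f x t Hf). assert (D2 := C1_derive1 u x t Hu).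
      unfold energy. auto_derive.
      + repeat split; [exists (partial1 f x t)|exists (partial1 u x t)]; assumption.
      + simpl. replace (Derive (fun x0 => f x0 t) x) with (partial1 f x t) by reflexivity.
        replace (Derive (fun x0 => u x0 t) x) with (partial1 u x t) by reflexivity.
        field.
    - intros x _. apply continuous2_1. now apply C1_partial2. }
  rewrite <- Hint.
  apply (is_derive_RInt_param (fun t s => f s t)).
  - apply filter_forall. intros y s _. exists (partial2 f s y). now apply C1_derive2.
  - intros s _. apply (continuous2_swap (partial2 f)). now apply C1_partial2.
  - apply filter_forall. intros y. apply ex_RInt_1. now apply C1_continuous.
Qed.

(** The increment of the generating function over one step of velocity [v], up to
    an error [o(tau)] that is uniform in [x], [t] and [v]. *)
Lemma calibration_step (u f : R -> R -> R) (g : R -> R) (T V e : R) :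
  class_C_2d 1 u -> periodic1 u -> global_classical_solution (partial1 u) g f ->
  0 < V -> 0 < e ->
  exists d, 0 < d /\ forall tau x v t, 0 < tau < d -> Rabs v <= V ->
    Rabs t <= T -> Rabs (t + tau) <= T ->
    Rabs (primitive f (x + tau * v) (t + tau) - primitive f x t
          - tau * (v * f x t - energy u f x t + energy u f 0 t)) <= tau * e.
Proof.
  intros Hu Hpu Hsol HV He.
  assert (Hf := proj1 Hsol). assert (Hpf : periodic1 f) by exact (proj1 (proj2 Hsol)).
  assert (Hfc := C1_continuous f Hf). assert (Huc := C1_continuous u Hu).
  destruct (strip_uniform f T (e / (3 * V)) Hfc Hpf) as [d1 [Hd1 H1]].
  { apply Rdiv_lt_0_compat; lra. }
  destruct (strip_uniform (energy u f) T (e / 3)) as [d2 [Hd2 H2]].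
  { now apply continuous2_energy. }
  { intros x y. unfold energy. now rewrite Hpf, Hpu. }
  { lra. }
  set (d := Rmin (d1 / (1 + V)) (Rmin d1 d2)).
  assert (Hd : 0 < d).
  { repeat apply Rmin_pos; try lra. apply Rdiv_lt_0_compat; lra. }
  exists d. split; [exact Hd|].
  intros tau x v t Htau Hv Ht Htt.
  assert (Ha : tau < d1 / (1 + V)) by (eapply Rlt_le_trans; [apply Htau|apply Rmin_l]).
  assert (Hb : tau < Rmin d1 d2) by (eapply Rlt_le_trans; [apply Htau|apply Rmin_r]).
  assert (Hb1 : tau < d1) by (eapply Rlt_le_trans; [apply Hb|apply Rmin_l]).
  assert (Hb2 : tau < d2) by (eapply Rlt_le_trans; [apply Hb|apply Rmin_r]).
  assert (Ha' : tau * V < d1).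
  { apply (Rmult_lt_compat_r (1 + V)) in Ha; [|lra].
    unfold Rdiv in Ha. rewrite Rmult_assoc, Rinv_l in Ha by lra. nra. }
  destruct (MVT_derive (fun q => primitive f q (t + tau)) (fun q => f q (t + tau))
              x (x + tau * v)) as [c [Hc Ec]].
  { intros; now apply primitive_derive1. }
  destruct (MVT_derive (fun s => primitive f x s)
              (fun s => energy u f 0 s - energy u f x s) t (t + tau)) as [c' [Hc' Ec']].
  { intros; now apply (primitive_derive2 u f g). }
  assert (Hcd := between_dist _ _ _ Hc). assert (Hcd' := between_dist _ _ _ Hc').
  assert (Hcs' := between_strip _ _ _ _ Hc' Ht Htt).
  replace (x + tau * v - x) with (tau * v) in Hcd, Ec by ring.
  replace (t + tau - t) with tau in Hcd', Ec' by ring.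
  rewrite Rabs_mult, (Rabs_pos_eq tau) in Hcd by lra. rewrite (Rabs_pos_eq tau) in Hcd' by lra.
  assert (K1 : Rabs (f c (t + tau) - f x t) < e / (3 * V)).
  { apply H1; try assumption.
    - assert (tau * Rabs v <= tau * V) by (apply Rmult_le_compat_l; lra). lra.
    - replace (t + tau - t) with tau by ring. rewrite Rabs_pos_eq; lra. }
  assert (K2 : Rabs (energy u f x c' - energy u f x t) < e / 3).
  { apply H2; try assumption; [|lra].
    replace (x - x) with 0 by ring. rewrite Rabs_R0. lra. }
  assert (K3 : Rabs (energy u f 0 c' - energy u f 0 t) < e / 3).
  { apply H2; try assumption; [|lra].
    replace (0 - 0) with 0 by ring. rewrite Rabs_R0. lra. }
  replace (primitive f (x + tau * v) (t + tau) - primitive f x t -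
           tau * (v * f x t - energy u f x t + energy u f 0 t))
    with (tau * (v * (f c (t + tau) - f x t) - (energy u f x c' - energy u f x t)
                 + (energy u f 0 c' - energy u f 0 t))) by lra.
  rewrite Rabs_mult, (Rabs_pos_eq tau) by lra. apply Rmult_le_compat_l; [lra|].
  assert (K1' : Rabs (v * (f c (t + tau) - f x t)) <= e / 3).
  { rewrite Rabs_mult. replace (e / 3) with (V * (e / (3 * V))) by (field; lra).
    apply Rmult_le_compat; try apply Rabs_pos; lra. }
  apply Rabs_le_between in K1'. apply Rabs_lt_between in K2.
  apply Rabs_lt_between in K3. apply Rabs_le_between. lra.
Qed.

(** Summing the one-step estimate over a polygonal path: its action, corrected by the squared
    distance of its velocity to the field [f], depends only on the
    endpoints (and on a fixed function of time). *)
Lemma calibration_sum (u f : R -> R -> R) (g : R -> R) (T V e : R) :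
  class_C_2d 1 u -> periodic1 u -> global_classical_solution (partial1 u) g f ->
  0 < T -> 0 < V -> 0 < e ->
  exists d, 0 < d /\ forall N tau (x v : nat -> R), 0 < tau < d -> INR N * tau = T ->
    (forall n, (n < 2 * N)%nat -> x (S n) = x n + tau * v n /\ Rabs (v n) <= V) ->
    let t := time T tau in
    Rabs (primitive f (x (2 * N)%nat) T - primitive f (x O) (- T)
          - sum_below (fun n => tau * (v n ^ 2 / 2 - u (x n) (t n)
                          - (v n - f (x n) (t n)) ^ 2 / 2 + energy u f 0 (t n))) (2 * N)) <= e.
Proof.
  intros Hu Hpu Hsol HT HV He.
  destruct (calibration_step u f g T V (e / (2 * T)) Hu Hpu Hsol HV) as [d [Hd H]].
  { apply Rdiv_lt_0_compat; lra. }
  exists d; split; [exact Hd|]. intros N tau x v Htau HN Hx t.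
  rewrite <- (time_end T tau N HN) at 1. rewrite <- (time_0 T tau).
  fold t.
  rewrite <- (sum_below_telescope (fun n => primitive f (x n) (t n))).
  assert (Hm : forall m, (m <= 2 * N)%nat ->
    Rabs (sum_below (fun n => primitive f (x (S n)) (t (S n)) - primitive f (x n) (t n)) m
     - sum_below (fun n => tau * (v n ^ 2 / 2 - u (x n) (t n)
                  - (v n - f (x n) (t n)) ^ 2 / 2 + energy u f 0 (t n))) m)
    <= INR m * (tau * (e / (2 * T)))).
  { induction m as [|m IH]; intros Hm.
    - simpl. rewrite Rminus_0_r, Rabs_R0. lra.
    - specialize (IH ltac:(lia)). destruct (Hx m ltac:(lia)) as [Hxm Hvm].
      specialize (H tau (x m) (v m) (t m) Htau Hvm).
      unfold t in H; rewrite <- time_S in H; fold t in H.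
      rewrite <- Hxm in H.
      specialize (H (time_bound T tau N m (proj1 Htau) HN ltac:(lia))
                    (time_bound T tau N (S m) (proj1 Htau) HN ltac:(lia))).
      cbn [sum_below]. rewrite S_INR.
      unfold energy in *.
      apply Rabs_le_between in H. apply Rabs_le_between in IH. apply Rabs_le_between.
      split; lra. }
  eapply Rle_trans; [apply Hm; lia|].
  rewrite mult_INR. simpl (INR 2). right.
  replace ((1 + 1) * INR N * (tau * (e / (2 * T))))
    with ((INR N * tau) * (2 * (e / (2 * T)))) by ring.
  rewrite HN. field. lra.
Qed.

(** * Symplectic Euler orbits *)

(** The recurrence holds on the whole grid from [- T] to [T]. The force is evaluated at the
    new position, which makes the scheme symplectic. *)
Definition euler_orbit (F : R -> R -> R) (T tau : R) (N : nat) (x p : nat -> R) : Prop :=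
  forall n, (n < 2 * N)%nat ->
    x (S n) = x n + tau * p n /\
    p (S n) = p n - tau * F (x (S n)) (time T tau (S n)).

Lemma euler_orbit_shift (F : R -> R -> R) (T tau : R) (N : nat) (x p : nat -> R) (k : Z) :
  periodic1 F -> euler_orbit F T tau N x p ->
  euler_orbit F T tau N (fun n => x n + IZR k) p.
Proof.
  intros HF H n Hn. destruct (H n Hn) as [H1 H2]. split; [rewrite H1; ring|].
  now rewrite (periodic1_Z F).
Qed.

Lemma euler_orbit_momentum (F : R -> R -> R) (T tau B : R) (N : nat) (x p : nat -> R) :
  euler_orbit F T tau N x p -> 0 < tau -> INR N * tau = T -> 0 <= B ->
  (forall q t, Rabs t <= T -> Rabs (F q t) <= B) ->
  forall n m, (n <= 2 * N)%nat -> (m <= 2 * N)%nat -> Rabs (p n - p m) <= 2 * T * B.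
Proof.
  intros Ho Ht HN HB HF.
  assert (H : forall k n, (n + k <= 2 * N)%nat -> Rabs (p (n + k)%nat - p n) <= INR k * tau * B).
  { induction k as [|k IH]; intros n Hn.
    - rewrite Nat.add_0_r, Rminus_diag. rewrite Rabs_R0; simpl; lra.
    - specialize (IH n ltac:(lia)). destruct (Ho (n + k)%nat ltac:(lia)) as [_ H2].
      rewrite <- Nat.add_succ_r in H2. rewrite H2, S_INR.
      assert (HF' := HF (x (n + S k)%nat) _ (time_bound T tau N (n + S k) Ht HN Hn)).
      set (a := F _ _) in *.
      replace (p (n + k)%nat - tau * a - p n) with (p (n + k)%nat - p n - tau * a) by ring.
      apply Rabs_le_between in HF'. apply Rabs_le_between in IH. apply Rabs_le_between.
      nra. }
  assert (H' : forall n m, (n <= m)%nat -> (m <= 2 * N)%nat -> Rabs (p m - p n) <= 2 * T * B).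
  { intros n m Hnm Hm. specialize (H (m - n)%nat n ltac:(lia)).
    replace (n + (m - n))%nat with m in H by lia.
    eapply Rle_trans; [exact H|]. apply Rmult_le_compat_r; [lra|].
    assert (K : INR (m - n) <= INR (2 * N)) by (apply le_INR; lia).
    rewrite mult_INR in K. simpl (INR 2) in K. rewrite <- HN.
    apply (Rmult_le_compat_r tau) in K; lra. }
  intros n m Hn Hm. destruct (le_ge_dec n m).
  - rewrite Rabs_minus_sym. now apply H'.
  - now apply H'.
Qed.

(** By the Burgers equation, the defect [p - f(x,t)] changes in one step by at most
    [tau] times a multiple of itself, up to [o(tau)]. *)
Lemma drift_step (u f : R -> R -> R) (g : R -> R) (T P M e : R) :
  class_C_2d 2 u -> periodic1 u -> global_classical_solution (partial1 u) g f ->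
  0 < P -> 0 < e -> (forall q t, Rabs t <= T -> Rabs (partial1 f q t) <= M) ->
  exists d, 0 < d /\ forall tau x p t, 0 < tau < d -> Rabs p <= P ->
    Rabs t <= T -> Rabs (t + tau) <= T ->
    let x' := x + tau * p in
    let p' := p - tau * partial1 u x' (t + tau) in
    Rabs ((p' - f x' (t + tau)) - (p - f x t)) <= tau * (M * Rabs (p - f x t) + e).
Proof.
  intros Hu Hpu Hsol HP He HM.
  assert (Hf := proj1 Hsol). assert (Hpf : periodic1 f) by exact (proj1 (proj2 Hsol)).
  assert (HF := C2_partial1_C1 u Hu).
  destruct (strip_uniform (partial1 u) T (e / 3) (C1_continuous _ HF)
    (periodic_partial1 u Hpu)) as [d1 [Hd1 H1]]; [lra|].
  destruct (strip_uniform (partial1 f) T (e / (3 * P)) (C1_partial1 _ Hf)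
    (periodic_partial1 f Hpf)) as [d2 [Hd2 H2]]; [apply Rdiv_lt_0_compat; lra|].
  destruct (strip_uniform (partial2 f) T (e / 3) (C1_partial2 _ Hf)
    (periodic_partial2 f Hpf)) as [d3 [Hd3 H3]]; [lra|].
  set (d0 := Rmin d1 (Rmin d2 d3)).
  assert (Hd0 : 0 < d0) by (repeat apply Rmin_pos; lra).
  exists (d0 / (1 + P)). split; [apply Rdiv_lt_0_compat; lra|].
  intros tau x p t Htau Hp Ht Htt x' p'.
  assert (Hsmall : tau * (1 + P) < d0).
  { apply (Rmult_lt_reg_r (/ (1 + P))); [apply Rinv_0_lt_compat; lra|].
    rewrite Rmult_assoc, Rinv_r by lra. unfold Rdiv in Htau. lra. }
  assert (Hd01 : d0 <= d1) by apply Rmin_l.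
  assert (Hd02 : d0 <= d2) by (eapply Rle_trans; [apply Rmin_r|apply Rmin_l]).
  assert (Hd03 : d0 <= d3) by (eapply Rle_trans; [apply Rmin_r|apply Rmin_r]).
  destruct (MVT_derive (fun z => f z (t + tau)) (fun z => partial1 f z (t + tau)) x x')
    as [c [Hc Ec]]. { intros; now apply C1_derive1. }
  destruct (MVT_derive (fun z => f x z) (fun z => partial2 f x z) t (t + tau))
    as [c' [Hc' Ec']]. { intros; now apply C1_derive2. }
  assert (Hcd := between_dist _ _ _ Hc). assert (Hcd' := between_dist _ _ _ Hc').
  assert (Hcs' := between_strip _ _ _ _ Hc' Ht Htt).
  assert (Hxx : Rabs (x' - x) <= tau * P).
  { unfold x'. replace (x + tau * p - x) with (tau * p) by ring.
    rewrite Rabs_mult, (Rabs_pos_eq tau) by lra. apply Rmult_le_compat_l; lra. }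
  replace (x' - x) with (tau * p) in Ec by (unfold x'; ring).
  replace (t + tau - t) with tau in Hcd', Ec' by ring. rewrite (Rabs_pos_eq tau) in Hcd' by lra.
  assert (Htp : 0 < tau * P) by (apply Rmult_lt_0_compat; lra).
  assert (Htt' : Rabs (t + tau - t) < d0).
  { replace (t + tau - t) with tau by ring. rewrite Rabs_pos_eq; lra. }
  assert (K1 : Rabs (partial1 u x' (t + tau) - partial1 u x t) < e / 3)
    by (apply H1; try assumption; lra).
  assert (K2 : Rabs (partial1 f c (t + tau) - partial1 f x t) < e / (3 * P))
    by (apply H2; try assumption; lra).
  assert (K3 : Rabs (partial2 f x c' - partial2 f x t) < e / 3).
  { apply H3; try assumption; [|lra].
    replace (x - x) with 0 by ring. rewrite Rabs_R0. lra. }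
  assert (K2' : Rabs (p * (partial1 f c (t + tau) - partial1 f x t)) <= e / 3).
  { rewrite Rabs_mult. replace (e / 3) with (P * (e / (3 * P))) by (field; lra).
    apply Rmult_le_compat; try apply Rabs_pos; lra. }
  assert (K4 : Rabs ((p - f x t) * partial1 f x t) <= M * Rabs (p - f x t)).
  { rewrite Rabs_mult, Rmult_comm. apply Rmult_le_compat_r; [apply Rabs_pos|now apply HM]. }
  assert (Heq := proj1 (proj2 (proj2 Hsol)) x t).
  (* the terms [F + f f_q + f_t] at (x, t) cancel *)
  replace (p' - f x' (t + tau) - (p - f x t)) with
    (- (tau * ((partial1 u x' (t + tau) - partial1 u x t)
           + p * (partial1 f c (t + tau) - partial1 f x t)
           + (partial2 f x c' - partial2 f x t)
           + (p - f x t) * partial1 f x t)))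
    by (unfold p'; nra).
  rewrite Rabs_Ropp, Rabs_mult, (Rabs_pos_eq tau) by lra.
  apply Rmult_le_compat_l; [lra|].
  apply Rabs_lt_between in K1. apply Rabs_le_between in K2'. apply Rabs_lt_between in K3.
  apply Rabs_le_between in K4. apply Rabs_le_between. lra.
Qed.

(** An Euler orbit which at time 0 is close to the graph of the initial
    condition stays close to the graphs of the solution, in both time
    directions. *)
Lemma drift (u f : R -> R -> R) (g : R -> R) (T P e : R) :
  class_C_2d 2 u -> periodic1 u -> global_classical_solution (partial1 u) g f ->
  0 < T -> 0 < P -> 0 < e ->
  exists d, 0 < d /\ forall N tau x p, 0 < tau < d -> INR N * tau = T ->
    euler_orbit (partial1 u) T tau N x p ->
    (forall n, (n <= 2 * N)%nat -> Rabs (p n) <= P) ->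
    Rabs (p N - f (x N) 0) <= d ->
    forall n, (n <= 2 * N)%nat -> Rabs (p n - f (x n) (time T tau n)) <= e.
Proof.
  intros Hu Hpu Hsol HT HP He.
  assert (Hf := proj1 Hsol). assert (Hpf : periodic1 f) by exact (proj1 (proj2 Hsol)).
  destruct (strip_bounded (partial1 f) T (C1_partial1 _ Hf) (periodic_partial1 f Hpf))
    as [M [HM HM']].
  set (E := exp (2 * M * T)). assert (HE : 0 < E) by apply exp_pos.
  destruct (drift_step u f g T P M (e / (4 * T * E)) Hu Hpu Hsol HP) as [d0 [Hd0 Hstep]];
    [|exact HM'|].
  { apply Rdiv_lt_0_compat; [lra|]. apply Rmult_lt_0_compat; lra. }
  set (c := e / (4 * T * E)) in *.
  assert (Hc : 0 < c).
  { apply Rdiv_lt_0_compat; [lra|]. apply Rmult_lt_0_compat; lra. }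
  set (d := Rmin d0 (Rmin (/ (2 * M)) (e / (2 * E)))).
  assert (Hd : 0 < d).
  { repeat apply Rmin_pos; [lra|apply Rinv_0_lt_compat; lra|apply Rdiv_lt_0_compat; lra]. }
  exists d. split; [exact Hd|].
  intros N tau x p Htau HN Ho Hp HpN.
  assert (Hd1 : d <= d0) by apply Rmin_l.
  assert (Hd2 : d <= / (2 * M)) by (eapply Rle_trans; [apply Rmin_r|apply Rmin_l]).
  assert (Hd3 : d <= e / (2 * E)) by (eapply Rle_trans; [apply Rmin_r|apply Rmin_r]).
  assert (HMt : M * tau <= / 2).
  { assert (M * tau <= M * / (2 * M)) by (apply Rmult_le_compat_l; lra).
    replace (M * / (2 * M)) with (/ 2) in H by (field; lra). lra. }
  set (y := fun n => Rabs (p n - f (x n) (time T tau n))).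
  assert (Hy0 : forall n, 0 <= y n) by (intros; apply Rabs_pos).
  assert (HyN : y N <= e / (2 * E)).
  { unfold y. rewrite time_mid by exact HN. lra. }
  assert (Hdiff : forall n, (n < 2 * N)%nat ->
    Rabs (y (S n) - y n) <= tau * (M * y n + c)).
  { intros n Hn. destruct (Ho n Hn) as [Hx1 Hp1].
    specialize (Hstep tau (x n) (p n) (time T tau n) ltac:(lra) (Hp n ltac:(lia))
      (time_bound T tau N n (proj1 Htau) HN ltac:(lia))).
    rewrite <- time_S in Hstep.
    specialize (Hstep (time_bound T tau N (S n) (proj1 Htau) HN ltac:(lia))).
    cbv zeta in Hstep. rewrite <- Hx1, <- Hp1 in Hstep.
    eapply Rle_trans; [apply Rabs_triang_inv2|exact Hstep]. }
  assert (Hfin : forall k z, (k <= N)%nat ->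
     z <= exp (2 * M * (INR k * tau)) * (y N + INR k * tau * (2 * c)) -> z <= e).
  { intros k z Hk Hz. eapply Rle_trans; [exact Hz|].
    assert (HkT : INR k * tau <= T).
    { rewrite <- HN. apply Rmult_le_compat_r; [lra|]. now apply le_INR. }
    assert (HkT0 : 0 <= INR k * tau) by (apply Rmult_le_pos; [apply pos_INR|lra]).
    replace e with (E * (e / (2 * E) + T * (2 * c))).
    2:{ unfold c. field. split; lra. }
    specialize (Hy0 N).
    apply Rmult_le_compat.
    - left; apply exp_pos.
    - assert (0 <= INR k * tau * (2 * c)) by (apply Rmult_le_pos; lra). lra.
    - unfold E. destruct (Rle_lt_or_eq_dec _ _ HkT) as [Hlt|Heq].
      + left. apply exp_increasing. apply Rmult_lt_compat_l; lra.
      + rewrite Heq. lra.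
    - apply Rplus_le_compat; [exact HyN|]. apply Rmult_le_compat_r; lra. }
  intros n Hn. fold (y n).
  destruct (le_ge_dec N n) as [Hle|Hge].
  - apply (Hfin (n - N)%nat); [lia|].
    replace (y n) with ((fun k => y (N + k)%nat) (n - N)%nat) by (cbv beta; f_equal; lia).
    replace (y N) with ((fun k => y (N + k)%nat) O) by (cbv beta; f_equal; lia).
    apply (discrete_gronwall _ tau (2 * c) (fun k => y (N + k)%nat) N); try lra; [auto| |lia].
    intros k Hk. rewrite Nat.add_succ_r.
    assert (Hq := Hdiff (N + k)%nat ltac:(lia)).
    apply Rabs_le_between in Hq. specialize (Hy0 (N + k)%nat).
    assert (0 <= tau * c) by (apply Rmult_le_pos; lra).
    assert (0 <= M * tau) by (apply Rmult_le_pos; lra). nra.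
  - apply (Hfin (N - n)%nat); [lia|].
    replace (y n) with ((fun k => y (N - k)%nat) (N - n)%nat) by (cbv beta; f_equal; lia).
    replace (y N) with ((fun k => y (N - k)%nat) O) by (cbv beta; f_equal; lia).
    apply (discrete_gronwall _ tau (2 * c) (fun k => y (N - k)%nat) N); try lra; [auto| |lia].
    intros k Hk.
    assert (Hq := Hdiff (N - S k)%nat ltac:(lia)).
    replace (S (N - S k)) with (N - k)%nat in Hq by lia.
    apply Rabs_le_between in Hq.
    generalize (Hy0 (N - S k)%nat) (Hy0 (N - k)%nat); intros.
    assert (0 <= tau * c) by (apply Rmult_le_pos; lra).
    assert (0 <= M * tau) by (apply Rmult_le_pos; lra).
    set (a := M * tau) in *. set (b := tau * c) in *.
    set (y1 := y (N - S k)%nat) in *. set (y2 := y (N - k)%nat) in *.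
    assert (y1 * (1 - a) <= y2 + b) by (unfold a, b; nra).
    replace (2 * M * tau) with (2 * a) by (unfold a; ring).
    replace (tau * (2 * c)) with (2 * b) by (unfold b; ring).
    (* (1 - a) (1 + 2 a) >= 1 because a <= 1/2 *)
    assert (y1 <= y1 * (1 - a) * (1 + 2 * a)).
    { replace (y1 * (1 - a) * (1 + 2 * a)) with (y1 + y1 * (a * (1 - 2 * a))) by ring.
      assert (0 <= y1 * (a * (1 - 2 * a))).
      { apply Rmult_le_pos; [lra|]. apply Rmult_le_pos; lra. } lra. }
    nra.
Qed.

(** * The variation of the action *)

(** The admissible perturbations [xi q p t], as functions on the extended phase space.
    Vanishing at times [T] and [- T] fixes the endpoints of perturbed paths. *)
Record variation_field (T L : R) (xi : R -> R -> R -> R) : Prop := {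
  vf_periodic : forall q p t, xi (q + 1) p t = xi q p t;
  vf_end : forall q p t, Rabs t = T -> xi q p t = 0;
  vf_lipschitz : forall q q' p p' t t', Rabs t <= T -> Rabs t' <= T ->
    Rabs (xi q' p' t' - xi q p t) <= L * (Rabs (q' - q) + Rabs (p' - p) + Rabs (t' - t))
}.

(** The potential at displacement [h], minus its first-order expansion. *)
Definition potential_excess (u : R -> R -> R) (q t h : R) : R :=
  u (q + h) t - u q t - partial1 u q t * h.

(** The contribution of one Euler step from (q, p) at time [t] to the change of
    the discrete action when the orbit is displaced by [xi]. The linear terms are absent: by the
    Euler equations they form a telescoping sum. *)
Definition variation (u : R -> R -> R) (tau : R) (xi : R -> R -> R -> R) (t q p : R) : R :=
  let q' := q + tau * p in
  let p' := p - tau * partial1 u q' (t + tau) in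
  (xi q' p' (t + tau) - xi q p t) ^ 2 / (2 * tau)
  - tau * potential_excess u q t (xi q p t).

(** The change of the discrete action along a whole orbit. *)
Definition total_variation (u : R -> R -> R) (T tau : R) (N : nat)
    (xi : R -> R -> R -> R) (x p : nat -> R) : R :=
  sum_below (fun n => variation u tau xi (time T tau n) (x n) (p n)) (2 * N).

Lemma potential_excess_periodic (u : R -> R -> R) (q t h : R) :
  periodic1 u -> potential_excess u (q + 1) t h = potential_excess u q t h.
Proof.
  intros Hu. unfold potential_excess. rewrite (periodic_partial1 u Hu).
  replace (q + 1 + h) with (q + h + 1) by ring. now rewrite !Hu.
Qed.

Lemma variation_periodic (u : R -> R -> R) (tau : R) (xi : R -> R -> R -> R) (t q p : R) :
  periodic1 u -> (forall q p t, xi (q + 1) p t = xi q p t) ->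
  variation u tau xi t (q + 1) p = variation u tau xi t q p.
Proof.
  intros Hu Hxi. unfold variation. rewrite Hxi.
  replace (q + 1 + tau * p) with (q + tau * p + 1) by ring.
  rewrite (periodic_partial1 u Hu), Hxi. now rewrite potential_excess_periodic.
Qed.

(** The calibration estimate is applied to the orbit, which follows the field [f]
    closely, and to the displaced path, for which the squared distance to the
    field is only known to be nonnegative. The point ([q0], [f q0 0]) of the
    graph of [f] is fixed; the estimate is uniform in a neighbourhood of it. *)
Lemma total_variation_lower_local (u f : R -> R -> R) (g : R -> R) (T L q0 e : R)
    (xi : R -> R -> R -> R) :
  class_C_2d 2 u -> periodic1 u -> global_classical_solution (partial1 u) g f ->
  0 < T -> 0 < L -> variation_field T L xi -> 0 < e ->
  exists d, 0 < d /\ forall N tau x p, 0 < tau < d -> INR N * tau = T ->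
    euler_orbit (partial1 u) T tau N x p ->
    Rabs (x N - q0) < d -> Rabs (p N - f q0 0) < d ->
    - e <= total_variation u T tau N xi x p.
Proof.
  intros Hu Hpu Hsol HT HL Hxi He.
  assert (Hu1 := C2_C1 u Hu).
  assert (HF := C2_partial1_C1 u Hu).
  assert (Hf := proj1 Hsol). assert (Hpf : periodic1 f) by exact (proj1 (proj2 Hsol)).
  destruct (strip_bounded (partial1 u) T (C1_continuous _ HF) (periodic_partial1 u Hpu))
    as [B [HB HB']].
  set (P := Rabs (f q0 0) + 1 + 2 * T * B).
  assert (HP : 0 < P).
  { unfold P. generalize (Rabs_pos (f q0 0)); intros.
    assert (0 < T * B) by (apply Rmult_lt_0_compat; lra). lra. }
  set (V := P + L * (P + B + 1)).
  assert (HV : 0 < V).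
  { unfold V. assert (0 < L * (P + B + 1)) by (apply Rmult_lt_0_compat; lra). lra. }
  set (e1 := Rmin 1 (e / (2 * T))).
  assert (He1 : 0 < e1) by (apply Rmin_pos; [lra|apply Rdiv_lt_0_compat; lra]).
  assert (He1' : T * (e1 * e1) <= e / 2).
  { assert (e1 <= 1) by apply Rmin_l. assert (e1 <= e / (2 * T)) by apply Rmin_r.
    replace (e / 2) with (T * (e / (2 * T))) by (field; lra).
    apply Rmult_le_compat_l; [lra|]. nra. }
  destruct (calibration_sum u f g T V (e / 4) Hu1 Hpu Hsol HT HV) as [dc [Hdc Hcal]]; [lra|].
  destruct (drift u f g T P e1 Hu Hpu Hsol HT HP He1) as [dd [Hdd Hdrift]].
  destruct (C1_continuous f Hf q0 0 (mkposreal (dd / 2) ltac:(lra))) as [df Hdf].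
  simpl in Hdf.
  exists (Rmin (Rmin dc 1) (Rmin (dd / 2) df)). split.
  { repeat apply Rmin_pos; try lra. apply cond_pos. }
  intros N tau x p Htau HN Ho HxN HpN. unfold total_variation.
  assert (M1 := Rmin_l (Rmin dc 1) (Rmin (dd / 2) df)).
  assert (M2 := Rmin_r (Rmin dc 1) (Rmin (dd / 2) df)).
  assert (M3 := Rmin_l dc 1). assert (M4 := Rmin_r dc 1).
  assert (M5 := Rmin_l (dd / 2) df). assert (M6 := Rmin_r (dd / 2) df).
  assert (HpP : forall n, (n <= 2 * N)%nat -> Rabs (p n) <= P).
  { intros n Hn.
    assert (Hm := euler_orbit_momentum _ _ _ B _ _ _ Ho (proj1 Htau) HN (Rlt_le _ _ HB)
      HB' n N Hn ltac:(lia)).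
    unfold P.
    replace (p n) with ((p n - p N) + ((p N - f q0 0) + f q0 0)) by ring.
    eapply Rle_trans; [apply Rabs_triang|]. generalize (Rabs_triang (p N - f q0 0) (f q0 0)).
    lra. }
  set (t := time T tau) in *.
  assert (Hcl : forall n, (n <= 2 * N)%nat -> Rabs (p n - f (x n) (t n)) <= e1).
  { apply (Hdrift N tau x p); try assumption; [lra|].
    specialize (Hdf (x N) 0 ltac:(lra)). rewrite Rminus_diag, Rabs_R0 in Hdf.
    specialize (Hdf (cond_pos df)).
    replace (p N - f (x N) 0) with ((p N - f q0 0) - (f (x N) 0 - f q0 0)) by ring.
    eapply Rle_trans; [apply Rabs_triang|]. rewrite Rabs_Ropp. lra. }
  (* [z] is the displaced path and [w] its discrete velocity *)
  set (xin := fun n => xi (x n) (p n) (t n)).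
  set (z := fun n => x n + xin n).
  set (w := fun n => p n + (xin (S n) - xin n) / tau).
  assert (Hx : forall n, (n < 2 * N)%nat -> x (S n) = x n + tau * p n /\ Rabs (p n) <= V).
  { intros n Hn. split; [apply Ho; lia|]. specialize (HpP n ltac:(lia)).
    unfold V. assert (0 < L * (P + B + 1)) by (apply Rmult_lt_0_compat; lra). lra. }
  assert (Hz : forall n, (n < 2 * N)%nat -> z (S n) = z n + tau * w n /\ Rabs (w n) <= V).
  { intros n Hn. destruct (Ho n Hn) as [Hx1 Hp1]. split.
    - unfold z, w. rewrite Hx1. field. lra.
    - unfold w, V. eapply Rle_trans; [apply Rabs_triang|].
      apply Rplus_le_compat; [apply HpP; lia|].
      unfold Rdiv. rewrite Rabs_mult, (Rabs_pos_eq (/ tau)).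
      2:{ left; apply Rinv_0_lt_compat; lra. }
      apply (Rmult_le_reg_r tau); [lra|]. rewrite Rmult_assoc, Rinv_l by lra. rewrite Rmult_1_r.
      unfold xin. eapply Rle_trans.
      { apply (vf_lipschitz _ _ _ Hxi);
          apply (time_bound T tau N); try lra; try lia; assumption. }
      assert (Hb := HB' (x (S n)) (t (S n))
                      (time_bound T tau N (S n) (proj1 Htau) HN ltac:(lia))).
      fold t in Hp1.
      replace (x (S n) - x n) with (tau * p n) by (rewrite Hx1; ring).
      replace (p (S n) - p n) with (- (tau * partial1 u (x (S n)) (t (S n))))
        by (rewrite Hp1; ring).
      replace (t (S n) - t n) with tau by (unfold t; rewrite time_S; ring).
      rewrite Rabs_Ropp, !Rabs_mult, (Rabs_pos_eq tau) by lra.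
      specialize (HpP n ltac:(lia)).
      rewrite (Rmult_assoc L (P + B + 1) tau). apply Rmult_le_compat_l; [lra|]. nra. }
  assert (Hxi0 : xin O = 0).
  { unfold xin. apply (vf_end _ _ _ Hxi). unfold t. rewrite time_0, Rabs_Ropp.
    apply Rabs_pos_eq; lra. }
  assert (Hxi1 : xin (2 * N)%nat = 0).
  { unfold xin. apply (vf_end _ _ _ Hxi). unfold t. rewrite time_end by exact HN.
    apply Rabs_pos_eq; lra. }
  assert (Cx := Hcal N tau x p ltac:(lra) HN Hx). cbv zeta in Cx.
  assert (Cz := Hcal N tau z w ltac:(lra) HN Hz). cbv zeta in Cz.
  fold t in Cx, Cz.
  replace (z O) with (x O) in Cz by (unfold z; rewrite Hxi0; ring).
  replace (z (2 * N)%nat) with (x (2 * N)%nat) in Cz by (unfold z; rewrite Hxi1; ring).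
  (* [b] sums by parts the part of the variation which is linear in [xi] *)
  set (b := fun n => (p n + tau * partial1 u (x n) (t n)) * xin n).
  assert (Hb : sum_below (fun n => b (S n) - b n) (2 * N) = 0).
  { rewrite sum_below_telescope. unfold b. rewrite Hxi0, Hxi1. ring. }
  set (A := fun n => tau * (w n ^ 2 / 2 - u (z n) (t n)
                        - (w n - f (z n) (t n)) ^ 2 / 2 + energy u f 0 (t n))) in *.
  set (A' := fun n => tau * (p n ^ 2 / 2 - u (x n) (t n)
                        - (p n - f (x n) (t n)) ^ 2 / 2 + energy u f 0 (t n))) in *.
  assert (Hlow : sum_below (fun n => A n + (-1) * A' n
                    + (-1) * (b (S n) - b n) + (- tau * (e1 * e1 / 2))) (2 * N)
     <= sum_below (fun n => variation u tau xi (t n) (x n) (p n)) (2 * N)).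
  { apply sum_below_le. intros n Hn. destruct (Ho n Hn) as [Hx1 Hp1].
    fold t in Hp1. unfold variation. cbv zeta.
    replace (t n + tau) with (t (S n)) by (unfold t; apply time_S).
    rewrite <- Hx1, <- Hp1.
    fold (t (S n)). fold (xin (S n)). fold (xin n).
    assert (Hbn : b (S n) = p n * xin (S n)).
    { unfold b. rewrite Hp1. fold t. ring. }
    rewrite Hbn. unfold A, A', b, w, potential_excess.
    fold (z n).
    assert (Hq : (p n - f (x n) (t n)) ^ 2 <= e1 * e1).
    { specialize (Hcl n ltac:(lia)).
      assert (Hsq := Rsqr_le_abs_1 (p n - f (x n) (t n)) e1).
      rewrite (Rabs_pos_eq e1) in Hsq by lra. specialize (Hsq Hcl).
      unfold Rsqr in Hsq. simpl. lra. }
    set (qq := (p n - f (x n) (t n)) ^ 2) in *.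
    replace ((p n + (xin (S n) - xin n) / tau) ^ 2 / 2) with
      (p n ^ 2 / 2 + p n * (xin (S n) - xin n) / tau
        + (xin (S n) - xin n) ^ 2 / (2 * tau) / tau) by (field; lra).
    set (ww := (p n + (xin (S n) - xin n) / tau - f (z n) (t n))).
    assert (Hww : 0 <= ww ^ 2) by apply pow2_ge_0.
    assert (Ht1 : 0 <= tau * ww ^ 2) by (apply Rmult_le_pos; lra).
    assert (Ht2 : tau * qq <= tau * (e1 * e1)) by (apply Rmult_le_compat_l; lra).
    set (k1 := (xin (S n) - xin n) ^ 2 / (2 * tau)).
    assert (E1 : tau * (k1 / tau) = k1) by (field; lra).
    assert (E2 : tau * (p n * (xin (S n) - xin n) / tau) = p n * (xin (S n) - xin n))
      by (field; lra).
    set (k2 := k1 / tau) in *. set (k3 := p n * (xin (S n) - xin n) / tau) in *.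
    set (ww2 := ww ^ 2) in *. set (pp := p n ^ 2).
    nra. }
  rewrite !sum_below_plus, !sum_below_scal, Hb, sum_below_const in Hlow.
  rewrite mult_INR in Hlow. simpl (INR 2) in Hlow.
  replace (- tau * ((1 + 1) * INR N * (e1 * e1 / 2)))
    with (- (INR N * tau * (e1 * e1))) in Hlow by field.
  rewrite HN in Hlow.
  apply Rabs_le_between in Cx. apply Rabs_le_between in Cz.
  eapply Rle_trans; [|exact Hlow]. lra.
Qed.

(** When the graphs of global solutions at time 0 cover the phase plane, every Euler
    orbit is almost minimizing, uniformly for bounded momenta at time 0. *)
Lemma total_variation_lower (u : R -> R -> R) (T L P e : R) (xi : R -> R -> R -> R) :
  class_C_2d 2 u -> periodic1 u ->
  (forall q p, exists f g, global_classical_solution (partial1 u) g f /\ f q 0 = p) ->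
  0 < T -> 0 < L -> variation_field T L xi -> 0 < e ->
  exists d, 0 < d /\ forall N tau x p, 0 < tau < d -> INR N * tau = T ->
    euler_orbit (partial1 u) T tau N x p -> Rabs (p N) <= P ->
    - e <= total_variation u T tau N xi x p.
Proof.
  intros Hu Hpu Hcover HT HL Hxi He.
  assert (Hloc : forall z : R * R, exists d : posreal, forall N tau x p,
    0 < tau < d -> INR N * tau = T ->
    euler_orbit (partial1 u) T tau N x p ->
    Rabs (x N - fst z) < d -> Rabs (p N - snd z) < d ->
    - e <= total_variation u T tau N xi x p).
  { intros [q0 p0]. destruct (Hcover q0 p0) as [f [g [Hsol Hf]]].
    destruct (total_variation_lower_local u f g T L q0 e xi Hu Hpu Hsol HT HL Hxi He)
      as [d [Hd H]].
    exists (mkposreal d Hd). simpl. rewrite <- Hf. exact H. }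
  apply choice in Hloc. destruct Hloc as [dl Hdl].
  destruct (compactness_value_2d 0 1 (- P) P (fun a b => dl (a, b))) as [d Hd].
  exists d. split; [apply cond_pos|].
  intros N tau x p Htau HN Ho HpN.
  apply Rabs_le_between in HpN.
  (* an integer translation brings the position at time 0 into [0, 1] *)
  destruct (shift_to_unit (x N)) as [k Hk].
  assert (Hsh := euler_orbit_shift _ T tau N x p k (periodic_partial1 u Hpu) Ho).
  replace (total_variation u T tau N xi x p)
    with (total_variation u T tau N xi (fun n => x n + IZR k) p).
  2:{ apply sum_below_ext. intros n _.
      apply (periodic1_Z (variation u tau xi (time T tau n)) k (x n) (p n)).
      intros q r. apply variation_periodic; [exact Hpu|apply (vf_periodic _ _ _ Hxi)]. }
  apply Rnot_lt_le. intros Hlt. apply (Hd (x N + IZR k) (p N)); [lra|lra|].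
  intros [a [b [Ha [Hb [H1 [H2 H3]]]]]]. apply (Rlt_not_le _ _ Hlt).
  apply (Hdl (a, b)); simpl; try assumption. lra.
Qed.

(** * Integration over the phase cylinder *)

Lemma continuous_RInt_parameter_le (G : R -> R -> R) (a b : R) :
  continuous2 G -> a <= b ->
  forall p, continuous (fun p => RInt (fun q => G q p) a b) p.
Proof.
  intros HG Hab p. apply filterlim_locally. intros [e He].
  assert (He' : 0 < e / (b - a + 1)) by (apply Rdiv_lt_0_compat; lra).
  destruct (uniform_continuity_2d_1d G a b p (fun x _ => HG x p) (mkposreal _ He')) as [d Hd].
  exists d. intros p' Hp'.
  unfold ball in *; simpl in *; unfold AbsRing_ball, abs, minus, plus, opp in *; simpl in *.
  change (Rabs (p' - p) < d) in Hp'.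
  change (Rabs (RInt (fun q => G q p') a b - RInt (fun q => G q p) a b) < e).
  assert (E : RInt (fun q => G q p') a b - RInt (fun q => G q p) a b
            = RInt (fun q => G q p' - G q p) a b).
  { symmetry. apply (RInt_minus (V := R_CompleteNormedModule)); now apply ex_RInt_1. }
  rewrite E.
  apply Rle_lt_trans with ((b - a) * (e / (b - a + 1))).
  - apply abs_RInt_le_const; [exact Hab| |].
    + apply (ex_RInt_minus (V := R_NormedModule)); now apply ex_RInt_1.
    + intros q Hq. apply Rabs_lt_between in Hp'.
      assert (Hd0 := cond_pos d).
      left. apply (Hd q p q p'); try lra.
      rewrite Rminus_diag, Rabs_R0. exact Hd0.
  - apply (Rmult_lt_reg_r (b - a + 1)); [lra|].
    replace ((b - a) * (e / (b - a + 1)) * (b - a + 1)) with ((b - a) * e) by (field; lra).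
    nra.
Qed.

Lemma continuous_RInt_parameter (G : R -> R -> R) (a b : R) :
  continuous2 G -> forall p, continuous (fun p => RInt (fun q => G q p) a b) p.
Proof.
  intros HG p. destruct (Rle_dec a b) as [Hab|Hab].
  - now apply continuous_RInt_parameter_le.
  - apply (continuous_ext (fun p => opp (RInt (fun q => G q p) b a))).
    + intros x. apply (opp_RInt_swap (V := R_CompleteNormedModule)). now apply ex_RInt_1.
    + apply (continuous_opp (V := R_NormedModule)). apply continuous_RInt_parameter_le; [assumption|lra].
Qed.

(** Both sides, as functions of the upper limit [d], vanish at [c] and have the
    same derivative. *)
Lemma RInt_exchange (G : R -> R -> R) (a b c d : R) :
  continuous2 G ->
  RInt (fun p => RInt (fun q => G q p) a b) c d
  = RInt (fun q => RInt (fun p => G q p) c d) a b.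
Proof.
  intros HG.
  set (Phi := fun y => RInt (fun q => RInt (fun p => G q p) c y) a b).
  assert (HD : forall q y, is_derive (fun z => RInt (fun p => G q p) c z) y (G q y)).
  { intros q y. apply (is_derive_RInt (fun p => G q p) _ c).
    - apply filter_forall. intros z. apply (RInt_correct (V := R_CompleteNormedModule)).
      now apply ex_RInt_2.
    - now apply continuous2_2. }
  assert (HPhi : forall y, is_derive Phi y (RInt (fun q => G q y) a b)).
  { intros y.
    replace (RInt (fun q => G q y) a b)
      with (RInt (fun q => Derive (fun z => RInt (fun p => G q p) c z) y) a b)
      by (apply RInt_ext; intros; apply is_derive_unique, HD).
    apply (is_derive_RInt_param (fun z q => RInt (fun p => G q p) c z)).
    - apply filter_forall. intros z q _. exists (G q z). apply HD.
    - intros q _. apply (continuity_2d_pt_ext (fun z q => G q z)).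
      + intros; symmetry; apply is_derive_unique, HD.
      + now apply continuous2_swap.
    - apply filter_forall. intros z.
      apply (ex_RInt_continuous (V := R_CompleteNormedModule)). intros q _.
      apply (continuous_RInt_parameter (fun p q => G q p)). now apply continuous2_swap. }
  replace (RInt (fun q => RInt (fun p => G q p) c d) a b) with (minus (Phi d) (Phi c)).
  - apply is_RInt_unique. apply (is_RInt_derive (V := R_CompleteNormedModule) Phi).
    + intros; apply HPhi.
    + intros; now apply continuous_RInt_parameter.
  - replace (Phi c) with 0; [unfold minus, plus, opp, Phi; simpl; ring|].
    unfold Phi. rewrite (RInt_ext _ (fun _ => 0)).
    + rewrite RInt_const. unfold scal; simpl; unfold mult; simpl; ring.
    + intros. apply (RInt_point (V := R_CompleteNormedModule)).
Qed.

Lemma RInt_Chasles_continuous (h : R -> R) (a b c : R) :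
  (forall x, continuous h x) -> RInt h a c = RInt h a b + RInt h b c.
Proof.
  intros H. symmetry.
  apply (RInt_Chasles (V := R_CompleteNormedModule) h);
    apply (ex_RInt_continuous (V := R_CompleteNormedModule)); intros; apply H.
Qed.

Lemma RInt_translate (h : R -> R) (s a b : R) :
  (forall x, continuous h x) ->
  RInt (fun x => h (x + s)) a b = RInt h (a + s) (b + s).
Proof.
  intros H.
  assert (E := RInt_comp_lin (V := R_CompleteNormedModule) h 1 s a b).
  replace (a + s) with (1 * a + s) by ring. replace (b + s) with (1 * b + s) by ring.
  rewrite <- E.
  - apply RInt_ext. intros x _. unfold scal; simpl; unfold mult; simpl. now rewrite !Rmult_1_l.
  - apply (ex_RInt_continuous (V := R_CompleteNormedModule)). intros; apply H.
Qed.

Lemma RInt_period (h : R -> R) (s : R) :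
  (forall x, continuous h x) -> (forall x, h (x + 1) = h x) ->
  RInt (fun x => h (x + s)) 0 1 = RInt h 0 1.
Proof.
  intros Hc Hp. rewrite RInt_translate by exact Hc.
  assert (Hex : forall a b, ex_RInt h a b).
  { intros. apply (ex_RInt_continuous (V := R_CompleteNormedModule)). intros; apply Hc. }
  set (H := (fun x => RInt h 0 x) : R -> R).
  assert (HH : forall x, is_derive H x (h x)).
  { intros x. apply (is_derive_RInt h _ 0); [|apply Hc].
    apply filter_forall. intros. apply (RInt_correct (V := R_CompleteNormedModule)). apply Hex. }
  assert (E : forall x, H (x + 1) - H x = RInt h x (x + 1)).
  { intros x. unfold H. rewrite (RInt_Chasles_continuous h 0 x (x + 1)) by exact Hc. ring. }
  replace (0 + s) with s by ring. replace (1 + s) with (s + 1) by ring.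
  rewrite <- E. change (H (s + 1) - H s = H 1).
  assert (E0 : H 0 = 0) by apply (RInt_point (V := R_CompleteNormedModule)).
  destruct (MVT_derive (fun x => H (x + 1) - H x) (fun x => h (x + 1) - h x) 0 s) as [c [_ Hc']].
  { intros x. apply (is_derive_minus (fun x => H (x + 1)) H x).
    - assert (D := is_derive_comp H (fun x => x + 1) x (h (x + 1)) 1 (HH (x + 1))).
      replace (h (x + 1)) with (scal 1 (h (x + 1))) by (unfold scal; simpl; unfold mult; simpl; ring).
      apply D. auto_derive; [exact I|ring].
    - apply HH. }
  rewrite Hp in Hc'. replace (0 + 1) with 1 in Hc' by ring. lra.
Qed.

Lemma RInt_vanish (h : R -> R) (a b : R) :
  (forall x, Rmin a b <= x <= Rmax a b -> h x = 0) -> RInt h a b = 0.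
Proof.
  intros H. rewrite (RInt_ext h (fun _ => 0)).
  - rewrite RInt_const. unfold scal; simpl; unfold mult; simpl; ring.
  - intros; apply H; lra.
Qed.

Lemma RInt_translate_support (h : R -> R) (A P s : R) :
  (forall x, continuous h x) -> (forall x, A <= Rabs x -> h x = 0) -> A + Rabs s <= P ->
  RInt (fun x => h (x + s)) (- P) P = RInt h (- P) P.
Proof.
  intros Hc Hs HP. rewrite RInt_translate by exact Hc.
  rewrite (RInt_Chasles_continuous h (- P + s) (- P) (P + s)) by exact Hc.
  rewrite (RInt_Chasles_continuous h (- P) P (P + s)) by exact Hc.
  assert (Z1 : RInt h (- P + s) (- P) = 0).
  { apply RInt_vanish. intros x Hx. apply Hs. revert Hx HP. unfold Rmin, Rmax, Rabs.
    destruct (Rle_dec (- P + s) (- P)); repeat destruct Rcase_abs; lra. }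
  assert (Z2 : RInt h P (P + s) = 0).
  { apply RInt_vanish. intros x Hx. apply Hs. revert Hx HP. unfold Rmin, Rmax, Rabs.
    destruct (Rle_dec P (P + s)); repeat destruct Rcase_abs; lra. }
  now rewrite Z1, Z2, Rplus_0_l, Rplus_0_r.
Qed.

(** The integral over one period in [q] and momenta between [- P] and [P]; all integrands that are
    transported by the dynamics have their support in this range. *)
Definition phase_integral (P : R) (G : R -> R -> R) : R :=
  RInt (fun p => RInt (fun q => G q p) 0 1) (- P) P.

Lemma ex_RInt_phase (G : R -> R -> R) (a b : R) :
  continuous2 G -> ex_RInt (fun p => RInt (fun q => G q p) 0 1) a b.
Proof.
  intros HG. apply (ex_RInt_continuous (V := R_CompleteNormedModule)).
  intros; now apply continuous_RInt_parameter.
Qed.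

Lemma phase_integral_plus (P : R) (G H : R -> R -> R) :
  continuous2 G -> continuous2 H ->
  phase_integral P (fun q p => G q p + H q p) = phase_integral P G + phase_integral P H.
Proof.
  intros HG HH. unfold phase_integral.
  rewrite (RInt_ext _ (fun p => RInt (fun q => G q p) 0 1 + RInt (fun q => H q p) 0 1)).
  - apply (RInt_plus (V := R_CompleteNormedModule)); now apply ex_RInt_phase.
  - intros p _. apply (RInt_plus (V := R_CompleteNormedModule)); now apply ex_RInt_1.
Qed.

Lemma continuous2_sum (G : nat -> R -> R -> R) (m : nat) :
  (forall n, (n < m)%nat -> continuous2 (G n)) ->
  continuous2 (fun q p => sum_below (fun n => G n q p) m).
Proof.
  induction m as [|m IH]; intros HG; cbn [sum_below].
  - apply continuous2_const.
  - apply continuous2_plus; [apply IH; intros; apply HG; lia | apply HG; lia].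
Qed.

Lemma phase_integral_sum (P : R) (G : nat -> R -> R -> R) (m : nat) :
  (forall n, (n < m)%nat -> continuous2 (G n)) ->
  phase_integral P (fun q p => sum_below (fun n => G n q p) m)
  = sum_below (fun n => phase_integral P (G n)) m.
Proof.
  induction m as [|m IH]; intros HG; cbn [sum_below].
  - apply RInt_vanish. intros. apply RInt_vanish. reflexivity.
  - rewrite phase_integral_plus.
    + rewrite IH; [reflexivity|]. intros; apply HG; lia.
    + apply continuous2_sum. intros; apply HG; lia.
    + apply HG; lia.
Qed.

(** The factor [2 P] is the area of the domain of integration. *)
Lemma phase_integral_lower (P c : R) (G : R -> R -> R) :
  0 <= P -> continuous2 G -> (forall q p, Rabs p <= P -> c <= G q p) ->
  2 * P * c <= phase_integral P G.
Proof.
  intros HP HG H. unfold phase_integral.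
  replace (2 * P * c) with (RInt (fun _ => c) (- P) P).
  2:{ rewrite RInt_const. unfold scal; simpl; unfold mult; simpl; ring. }
  apply RInt_le; [lra|apply ex_RInt_const|now apply ex_RInt_phase|].
  intros p Hp. replace c with (RInt (fun _ => c) 0 1).
  2:{ rewrite RInt_const. unfold scal; simpl; unfold mult; simpl; ring. }
  apply RInt_le; [lra|apply ex_RInt_const|now apply ex_RInt_1|].
  intros q _. apply H. apply Rabs_le_between. lra.
Qed.

(** The symplectic Euler map is a composition of two shears, each of
    which preserves area. *)
Lemma phase_integral_euler_step (F G : R -> R -> R) (tau t A B P : R) :
  continuous2 F -> periodic1 F -> continuous2 G -> periodic1 G ->
  0 <= tau -> (forall q, Rabs (F q t) <= B) ->
  (forall q p, A <= Rabs p -> G q p = 0) -> A + tau * B <= P ->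
  phase_integral P (fun q p => G (q + tau * p) (p - tau * F (q + tau * p) t))
  = phase_integral P G.
Proof.
  intros HF HpF HG HpG Ht HB Hs HP.
  set (H := fun q p => G q (p - tau * F q t)).
  assert (HFt : continuous2 (fun q _ => F q t)).
  { apply (continuous2_comp F (fun q _ => q) (fun _ _ => t));
      [exact HF|apply continuous2_fst|apply continuous2_const]. }
  assert (HH : continuous2 H).
  { apply (continuous2_comp G (fun q _ => q) (fun q p => p - tau * F q t));
      [exact HG|apply continuous2_fst|].
    apply continuous2_minus; [apply continuous2_snd|].
    now apply (continuous2_mult (fun _ _ => tau)); [apply continuous2_const|]. }
  transitivity (phase_integral P H).
  - apply RInt_ext. intros p _.
    apply (RInt_period (fun q => H q p) (tau * p)).
    + intros; now apply continuous2_1.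
    + intros x. unfold H. now rewrite HpF, HpG.
  - unfold phase_integral. rewrite (RInt_exchange H) by exact HH. rewrite (RInt_exchange G) by exact HG.
    apply RInt_ext. intros q _. unfold H.
    apply (RInt_translate_support (fun p => G q p) A P (- (tau * F q t))).
    + now apply continuous2_2.
    + intros; now apply Hs.
    + rewrite Rabs_Ropp, Rabs_mult, (Rabs_pos_eq tau) by exact Ht.
      assert (tau * Rabs (F q t) <= tau * B) by (apply Rmult_le_compat_l; auto). lra.
Qed.

(** The state at time index [n] of the Euler orbit starting from (q, p) at time
    [- T]. *)
Fixpoint euler_flow (F : R -> R -> R) (T tau : R) (n : nat) (q p : R) : R * R :=
  match n with
  | O => (q, p)
  | S k =>
      let z := euler_flow F T tau k q p in
      let x := fst z + tau * snd z in
      (x, snd z - tau * F x (time T tau (S k)))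
  end.

Lemma euler_flow_orbit (F : R -> R -> R) (T tau q p : R) (N : nat) :
  euler_orbit F T tau N (fun n => fst (euler_flow F T tau n q p))
    (fun n => snd (euler_flow F T tau n q p)).
Proof. intros n _. split; reflexivity. Qed.

Lemma continuous2_euler_flow (F : R -> R -> R) (T tau : R) (n : nat) :
  continuous2 F ->
  continuous2 (fun q p => fst (euler_flow F T tau n q p)) /\
  continuous2 (fun q p => snd (euler_flow F T tau n q p)).
Proof.
  intros HF. induction n as [|n [IH1 IH2]]; cbn [euler_flow fst snd].
  - split; [apply continuous2_fst|apply continuous2_snd].
  - assert (H : continuous2 (fun q p => fst (euler_flow F T tau n q p)
                                    + tau * snd (euler_flow F T tau n q p))).
    { apply continuous2_plus; [exact IH1|].
      now apply (continuous2_mult (fun _ _ => tau)); [apply continuous2_const|]. }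
    split; [exact H|]. apply continuous2_minus; [exact IH2|].
    apply (continuous2_mult (fun _ _ => tau)); [apply continuous2_const|].
    apply (continuous2_comp F _ (fun _ _ => time T tau (S n)));
      [exact HF|exact H|apply continuous2_const].
Qed.

(** Each step enlarges the support in the momentum by at most [tau B]. *)
Lemma phase_integral_euler_flow (F : R -> R -> R) (T tau B P : R) (N n : nat) :
  continuous2 F -> periodic1 F -> 0 < tau -> INR N * tau = T -> 0 <= B ->
  (forall q t, Rabs t <= T -> Rabs (F q t) <= B) -> (n <= 2 * N)%nat ->
  forall G A, continuous2 G -> periodic1 G ->
  (forall q p, A <= Rabs p -> G q p = 0) -> A + INR n * tau * B <= P ->
  phase_integral P (fun q p => G (fst (euler_flow F T tau n q p))
                                 (snd (euler_flow F T tau n q p)))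
  = phase_integral P G.
Proof.
  intros HF HpF Ht HN HB HFB. induction n as [|n IH]; intros Hn G A HG HpG Hs HP.
  - reflexivity.
  - rewrite S_INR in HP.
    assert (HtB : 0 <= tau * B) by (apply Rmult_le_pos; lra).
    assert (HnB : 0 <= INR n * tau * B).
    { rewrite Rmult_assoc. apply Rmult_le_pos; [apply pos_INR|exact HtB]. }
    assert (HFB' : forall q, Rabs (F q (time T tau (S n))) <= B).
    { intros; apply HFB. now apply (time_bound T tau N). }
    rewrite <- (phase_integral_euler_step F G tau (time T tau (S n)) A B P);
      try assumption; try lra.
    cbn [euler_flow fst snd].
    set (t' := time T tau (S n)) in *.
    apply (IH ltac:(lia)
      (fun x y => G (x + tau * y) (y - tau * F (x + tau * y) t')) (A + tau * B)).
    + assert (Hx : continuous2 (fun x y => x + tau * y)).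
      { apply continuous2_plus; [apply continuous2_fst|].
        apply (continuous2_mult (fun _ _ => tau));
          [apply continuous2_const|apply continuous2_snd]. }
      apply (continuous2_comp G); [exact HG|exact Hx|].
      apply continuous2_minus; [apply continuous2_snd|].
      apply (continuous2_mult (fun _ _ => tau)); [apply continuous2_const|].
      apply (continuous2_comp F _ (fun _ _ => t')); [exact HF|exact Hx|apply continuous2_const].
    + intros x y. replace (x + 1 + tau * y) with (x + tau * y + 1) by ring.
      now rewrite HpF, HpG.
    + intros q p Hp. apply Hs. specialize (HFB' (q + tau * p)).
      assert (Htri := Rabs_triang_inv p (tau * F (q + tau * p) t')).
      rewrite Rabs_mult, (Rabs_pos_eq tau) in Htri by lra.
      assert (tau * Rabs (F (q + tau * p) t') <= tau * B) by (apply Rmult_le_compat_l; lra).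
      lra.
    + lra.
Qed.

Lemma variation_field_continuous (T L t : R) (xi : R -> R -> R -> R) :
  0 < L -> variation_field T L xi -> Rabs t <= T -> continuous2 (fun q p => xi q p t).
Proof.
  intros HL Hxi Ht q p [e He].
  assert (Hd : 0 < e / (2 * L)) by (apply Rdiv_lt_0_compat; lra).
  exists (mkposreal _ Hd). intros q' p' Hq Hp. simpl in *.
  eapply Rle_lt_trans; [apply (vf_lipschitz _ _ _ Hxi); assumption|].
  rewrite Rminus_diag, Rabs_R0.
  replace e with (L * (e / (2 * L) + e / (2 * L))) by (field; lra).
  apply Rmult_lt_compat_l; lra.
Qed.

Lemma continuous2_variation (u : R -> R -> R) (T L tau t : R) (xi : R -> R -> R -> R) :
  class_C_2d 2 u -> 0 < L -> variation_field T L xi -> Rabs t <= T -> Rabs (t + tau) <= T ->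
  continuous2 (variation u tau xi t).
Proof.
  intros Hu HL Hxi Ht Ht'.
  assert (HF := C1_continuous _ (C2_partial1_C1 u Hu)).
  assert (Huc := C1_continuous _ (C2_C1 u Hu)).
  assert (H1 := variation_field_continuous T L t xi HL Hxi Ht).
  assert (H2 := variation_field_continuous T L (t + tau) xi HL Hxi Ht').
  assert (Hx : continuous2 (fun x y => x + tau * y)).
  { apply continuous2_plus; [apply continuous2_fst|].
    apply (continuous2_mult (fun _ _ => tau)); [apply continuous2_const|apply continuous2_snd]. }
  assert (Hp : continuous2 (fun q p => p - tau * partial1 u (q + tau * p) (t + tau))).
  { apply continuous2_minus; [apply continuous2_snd|].
    apply (continuous2_mult (fun _ _ => tau)); [apply continuous2_const|].
    apply (continuous2_comp (partial1 u) _ (fun _ _ => t + tau));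
      [exact HF|exact Hx|apply continuous2_const]. }
  unfold variation, potential_excess. cbv zeta.
  apply continuous2_minus.
  - apply (continuous2_mult _ (fun _ _ => / (2 * tau))); [|apply continuous2_const].
    apply continuous2_pow. apply continuous2_minus; [|exact H1].
    now apply (continuous2_comp (fun a b => xi a b (t + tau))).
  - apply (continuous2_mult (fun _ _ => tau)); [apply continuous2_const|].
    apply continuous2_minus; [apply continuous2_minus|].
    + apply (continuous2_comp u _ (fun _ _ => t)); [exact Huc| |apply continuous2_const].
      apply continuous2_plus; [apply continuous2_fst|exact H1].
    + apply (continuous2_comp u _ (fun _ _ => t));
        [exact Huc|apply continuous2_fst|apply continuous2_const].
    + apply continuous2_mult; [|exact H1].
      apply (continuous2_comp (partial1 u) _ (fun _ _ => t));
        [exact HF|apply continuous2_fst|apply continuous2_const].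
Qed.

(** Averaged over phase space, the total variation of the action is asymptotically
    nonnegative. By area preservation, the average of the [n]-th summand over
    initial states is its plain integral over the phase cylinder. *)
Lemma mean_variation_lower (u : R -> R -> R) (T L A B P e : R) (xi : R -> R -> R -> R) :
  class_C_2d 2 u -> periodic1 u ->
  (forall q p, exists f g, global_classical_solution (partial1 u) g f /\ f q 0 = p) ->
  0 < T -> 0 < L -> variation_field T L xi ->
  (forall q p t, A <= Rabs p -> xi q p t = 0) ->
  0 <= A -> 0 < B -> (forall q t, Rabs t <= T -> Rabs (partial1 u q t) <= B) ->
  A + 3 * T * B <= P -> 0 < e ->
  exists d, 0 < d /\ forall N tau, 0 < tau < d -> INR N * tau = T ->
    - e <= sum_below (fun n => phase_integral P (variation u tau xi (time T tau n))) (2 * N).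
Proof.
  intros Hu Hpu Hcover HT HL Hxi Hsupp HA HB HFB HP He.
  assert (HTB : 0 < T * B) by (apply Rmult_lt_0_compat; lra).
  assert (HPpos : 0 < P) by lra.
  destruct (total_variation_lower u T L (P + 2 * T * B) (e / (2 * P)) xi Hu Hpu Hcover HT HL Hxi)
    as [d [Hd H]]; [apply Rdiv_lt_0_compat; lra|].
  exists (Rmin d T). split; [apply Rmin_pos; lra|].
  intros N tau Htau HN.
  assert (tau < d) by (eapply Rlt_le_trans; [apply Htau|apply Rmin_l]).
  assert (tau < T) by (eapply Rlt_le_trans; [apply Htau|apply Rmin_r]).
  assert (HF := C1_continuous _ (C2_partial1_C1 u Hu)).
  assert (HpF := periodic_partial1 u Hpu).
  assert (HV : forall n, (n < 2 * N)%nat ->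
    continuous2 (variation u tau xi (time T tau n))).
  { intros n Hn. apply (continuous2_variation u T L); try assumption.
    - apply (time_bound T tau N); [lra|exact HN|lia].
    - rewrite <- time_S. apply (time_bound T tau N); [lra|exact HN|lia]. }
  set (x := fun n q p => fst (euler_flow (partial1 u) T tau n q p)).
  set (y := fun n q p => snd (euler_flow (partial1 u) T tau n q p)).
  assert (HVf : forall n, (n < 2 * N)%nat -> continuous2 (fun q p =>
     variation u tau xi (time T tau n) (x n q p) (y n q p))).
  { intros n Hn. destruct (continuous2_euler_flow (partial1 u) T tau n HF).
    apply (continuous2_comp (variation u tau xi (time T tau n)) (x n) (y n));
      [now apply HV| |]; assumption. }
  rewrite (sum_below_ext _ (fun n => phase_integral P (fun q p =>
     variation u tau xi (time T tau n) (x n q p) (y n q p)))).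
  - rewrite <- (phase_integral_sum P (fun n q p =>
       variation u tau xi (time T tau n) (x n q p) (y n q p))) by exact HVf.
    replace (- e) with (2 * P * - (e / (2 * P))) by (field; lra).
    apply phase_integral_lower; [lra|now apply continuous2_sum|].
    intros q p Hp. apply (H N tau (fun n => x n q p) (fun n => y n q p));
      [lra|exact HN|apply euler_flow_orbit|].
    assert (Hm := euler_orbit_momentum _ _ _ B _ _ _
       (euler_flow_orbit (partial1 u) T tau q p N) (proj1 Htau) HN (Rlt_le _ _ HB) HFB
       N O ltac:(lia) ltac:(lia)).
    cbn [euler_flow snd] in Hm. unfold y.
    set (a := snd (euler_flow (partial1 u) T tau N q p)) in *.
    assert (Htr := Rabs_triang_inv a p). lra.
  - intros n Hn. symmetry. unfold x, y.
    apply (phase_integral_euler_flow (partial1 u) T tau B P N n) with (A := A + tau * B);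
      try assumption; try lra; try lia.
    + now apply HV.
    + intros a b. apply variation_periodic; [exact Hpu|apply (vf_periodic _ _ _ Hxi)].
    + intros q p Hp. unfold variation, potential_excess.
      assert (0 <= tau * B) by (apply Rmult_le_pos; lra).
      rewrite (Hsupp q p) by lra. cbv zeta. rewrite Hsupp.
      * rewrite Rplus_0_r. unfold Rdiv. ring.
      * assert (HF' := HFB (q + tau * p) (time T tau n + tau)).
        rewrite <- time_S in *.
        specialize (HF' (time_bound T tau N (S n) (proj1 Htau) HN ltac:(lia))).
        assert (Htri := Rabs_triang_inv p (tau * partial1 u (q + tau * p) (time T tau (S n)))).
        rewrite Rabs_mult, (Rabs_pos_eq tau) in Htri by lra.
        assert (tau * Rabs (partial1 u (q + tau * p) (time T tau (S n))) <= tau * B)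
          by (apply Rmult_le_compat_l; lra).
        lra.
    + assert (Hn2 : INR n * tau <= 2 * T).
      { assert (INR n <= INR (2 * N)) by (apply le_INR; lia).
        rewrite mult_INR in H2. simpl (INR 2) in H2. rewrite <- HN.
        apply (Rmult_le_compat_r tau) in H2; lra. }
      assert (INR n * tau * B <= 2 * T * B) by (apply Rmult_le_compat_r; lra).
      assert (tau * B <= T * B) by (apply Rmult_le_compat_r; lra).
      lra.
Qed.

(** * The test field *)

(** Truncation to the interval from 0 to 1. *)
Definition clamp (z : R) : R := Rmax 0 (Rmin 1 z).

Lemma clamp_bounds (z : R) : 0 <= clamp z <= 1.
Proof. unfold clamp, Rmax, Rmin. repeat destruct Rle_dec; lra. Qed.

Lemma clamp_0 (z : R) : z <= 0 -> clamp z = 0.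
Proof. unfold clamp, Rmax, Rmin. repeat destruct Rle_dec; lra. Qed.

Lemma clamp_1 (z : R) : 1 <= z -> clamp z = 1.
Proof. unfold clamp, Rmax, Rmin. repeat destruct Rle_dec; lra. Qed.

Lemma clamp_lipschitz (a b : R) : Rabs (clamp a - clamp b) <= Rabs (a - b).
Proof.
  unfold clamp, Rmax, Rmin, Rabs.
  repeat (destruct Rle_dec || destruct Rcase_abs); lra.
Qed.

(** Size of a point of the (momentum, time) plane; it is at least 1, so that its
    logarithm and its inverse are harmless. *)
Definition radius (p t : R) : R := 1 + Rabs p + Rabs t.

(** Equal to 1 where the radius is at most [R0], to 0 where it is at least [R1],
    and linear in its logarithm in between. *)
Definition log_cutoff (R0 R1 p t : R) : R :=
  clamp ((ln R1 - ln (radius p t)) / (ln R1 - ln R0)).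

(** A Lipschitz bump with support in the region where [log_cutoff R0 R1] equals 1. *)
Definition bump (R0 p t : R) : R := clamp (R0 - radius p t).

(** The change of the force under the translation by [c]. *)
Definition force_gap (u : R -> R -> R) (c q t : R) : R :=
  partial1 u (q + c) t - partial1 u q t.

(** A translation by [c], cut off logarithmically in the (momentum, time) plane, plus
    [s] times a localized force gap, the direction in which the action of the
    translated orbit decreases to first order. *)
Definition test_field (u : R -> R -> R) (c s R0 R1 q p t : R) : R :=
  c * log_cutoff R0 R1 p t + s * (force_gap u c q t * bump R0 p t).

Lemma radius_ge_1 (p t : R) : 1 <= radius p t.
Proof. unfold radius. generalize (Rabs_pos p) (Rabs_pos t); lra. Qed.

Lemma radius_lipschitz (p t p' t' : R) :
  Rabs (radius p' t' - radius p t) <= Rabs (p' - p) + Rabs (t' - t).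
Proof.
  unfold radius. generalize (Rabs_triang_inv2 p' p) (Rabs_triang_inv2 t' t). intros H1 H2.
  apply Rabs_le_between in H1. apply Rabs_le_between in H2. apply Rabs_le_between. lra.
Qed.

Lemma ln_lipschitz (m a b : R) :
  0 < m -> m <= a -> m <= b -> Rabs (ln b - ln a) <= / m * Rabs (b - a).
Proof.
  intros Hm.
  assert (H : forall a b, m <= a -> a <= b -> ln b - ln a <= / m * (b - a)).
  { intros x y Hx Hy. rewrite <- ln_div by lra.
    assert (E : y / x = 1 + (y - x) / x) by (field; lra).
    apply Rle_trans with ((y - x) / x).
    - rewrite E. assert (0 <= (y - x) / x).
      { apply Rmult_le_pos; [lra|left; apply Rinv_0_lt_compat; lra]. }
      rewrite <- (ln_exp ((y - x) / x)) at 2. apply ln_le; [lra|]. apply exp_ineq1_le.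
    - unfold Rdiv. rewrite Rmult_comm. apply Rmult_le_compat_r; [lra|].
      apply Rinv_le_contravar; lra. }
  intros Ha Hb. destruct (Rle_dec a b) as [Hab|Hab].
  - assert (0 <= ln b - ln a) by (assert (ln a <= ln b) by (apply ln_le; lra); lra).
    rewrite !Rabs_pos_eq by lra. now apply H.
  - assert (0 <= ln a - ln b) by (assert (ln b <= ln a) by (apply ln_le; lra); lra).
    rewrite (Rabs_minus_sym (ln b)), (Rabs_minus_sym b), !Rabs_pos_eq by lra. apply H; lra.
Qed.

Lemma log_cutoff_lipschitz (R0 R1 m p t p' t' : R) :
  0 < R0 < R1 -> 0 < m -> m <= radius p t -> m <= radius p' t' ->
  Rabs (log_cutoff R0 R1 p' t' - log_cutoff R0 R1 p t)
  <= / (ln R1 - ln R0) * (/ m * Rabs (radius p' t' - radius p t)).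
Proof.
  intros HR Hm H1 H2. unfold log_cutoff.
  assert (HL : 0 < ln R1 - ln R0) by (assert (ln R0 < ln R1) by (apply ln_increasing; lra); lra).
  eapply Rle_trans; [apply clamp_lipschitz|].
  replace ((ln R1 - ln (radius p' t')) / (ln R1 - ln R0) -
    (ln R1 - ln (radius p t)) / (ln R1 - ln R0))
    with (/ (ln R1 - ln R0) * - (ln (radius p' t') - ln (radius p t))) by (field; lra).
  rewrite Rabs_mult, Rabs_Ropp, (Rabs_pos_eq (/ _)).
  2:{ left; now apply Rinv_0_lt_compat. }
  apply Rmult_le_compat_l; [left; now apply Rinv_0_lt_compat|]. now apply ln_lipschitz.
Qed.

Lemma log_cutoff_inside (R0 R1 p t : R) :
  R0 < R1 -> radius p t <= R0 -> log_cutoff R0 R1 p t = 1.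
Proof.
  intros HR Hr. generalize (radius_ge_1 p t); intros H1. apply clamp_1.
  assert (ln R0 < ln R1) by (apply ln_increasing; lra).
  assert (ln (radius p t) <= ln R0) by (apply ln_le; lra).
  apply (Rmult_le_reg_r (ln R1 - ln R0)); [lra|].
  unfold Rdiv. rewrite Rmult_assoc, Rinv_l by lra. lra.
Qed.

Lemma log_cutoff_outside (R0 R1 p t : R) :
  0 < R0 < R1 -> R1 <= radius p t -> log_cutoff R0 R1 p t = 0.
Proof.
  intros HR Hr. apply clamp_0.
  assert (ln R0 < ln R1) by (apply ln_increasing; lra).
  assert (ln R1 <= ln (radius p t)) by (apply ln_le; lra).
  apply (Rmult_le_reg_r (ln R1 - ln R0)); [lra|].
  unfold Rdiv. rewrite Rmult_assoc, Rinv_l by lra. lra.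
Qed.

Lemma bump_outside (R0 p t : R) : R0 <= radius p t -> bump R0 p t = 0.
Proof. intros H. apply clamp_0. lra. Qed.

Lemma bump_lipschitz (R0 p t p' t' : R) :
  Rabs (bump R0 p' t' - bump R0 p t) <= Rabs (radius p' t' - radius p t).
Proof.
  unfold bump. eapply Rle_trans; [apply clamp_lipschitz|].
  replace (R0 - radius p' t' - (R0 - radius p t))
    with (- (radius p' t' - radius p t)) by ring. rewrite Rabs_Ropp. lra.
Qed.

Lemma bumped_gap_lipschitz (u : R -> R -> R) (c R0 T B L q p t q' p' t' : R) :
  (forall q t, Rabs t <= T -> Rabs (partial1 u q t) <= B) ->
  (forall x y t s, Rabs t <= T -> Rabs s <= T ->
    Rabs (partial1 u y s - partial1 u x t) <= L * (Rabs (y - x) + Rabs (s - t))) ->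
  Rabs t <= T -> Rabs t' <= T ->
  Rabs (force_gap u c q' t' * bump R0 p' t' - force_gap u c q t * bump R0 p t)
  <= 2 * L * (Rabs (q' - q) + Rabs (t' - t)) + 2 * B * (Rabs (p' - p) + Rabs (t' - t)).
Proof.
  intros HB HL Ht Ht'.
  assert (G1 : Rabs (force_gap u c q' t' - force_gap u c q t)
     <= 2 * L * (Rabs (q' - q) + Rabs (t' - t))).
  { unfold force_gap.
    assert (H1 := HL (q + c) (q' + c) t t' Ht Ht'). assert (H2 := HL q q' t t' Ht Ht').
    replace (q' + c - (q + c)) with (q' - q) in H1 by ring.
    apply Rabs_le_between in H1. apply Rabs_le_between in H2. apply Rabs_le_between. lra. }
  assert (G2 : Rabs (force_gap u c q t) <= 2 * B).
  { unfold force_gap. assert (H1 := HB (q + c) t Ht). assert (H2 := HB q t Ht).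
    apply Rabs_le_between in H1. apply Rabs_le_between in H2. apply Rabs_le_between. lra. }
  replace (force_gap u c q' t' * bump R0 p' t' - force_gap u c q t * bump R0 p t)
    with ((force_gap u c q' t' - force_gap u c q t) * bump R0 p' t'
          + force_gap u c q t * (bump R0 p' t' - bump R0 p t)) by ring.
  eapply Rle_trans; [apply Rabs_triang|]. rewrite !Rabs_mult.
  assert (Hb := clamp_bounds (R0 - radius p' t')). fold (bump R0 p' t') in Hb.
  rewrite (Rabs_pos_eq (bump R0 p' t')) by lra.
  assert (Hbl := bump_lipschitz R0 p t p' t'). assert (Hrl := radius_lipschitz p t p' t').
  apply Rplus_le_compat.
  - rewrite <- (Rmult_1_r (2 * L * _)). apply Rmult_le_compat; try lra. apply Rabs_pos.
  - apply Rmult_le_compat; try apply Rabs_pos; lra.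
Qed.

Lemma test_field_variation_field (u : R -> R -> R) (c s R0 R1 : R) :
  class_C_2d 2 u -> periodic1 u -> 1 < R0 < R1 -> 0 <= s ->
  exists L, 0 < L /\ variation_field R1 L (test_field u c s R0 R1).
Proof.
  intros Hu Hpu HR Hs.
  assert (HF := C2_partial1_C1 u Hu). assert (HpF := periodic_partial1 u Hpu).
  destruct (strip_bounded (partial1 u) R1 (C1_continuous _ HF) HpF) as [B [HB HB']].
  destruct (strip_lipschitz (partial1 u) R1 HF HpF) as [L [HL HL']].
  assert (HLn : 0 < / (ln R1 - ln R0)).
  { apply Rinv_0_lt_compat. assert (ln R0 < ln R1) by (apply ln_increasing; lra). lra. }
  set (k := / (ln R1 - ln R0)) in *.
  assert (Hc := Rabs_pos c).
  assert (Hck : 0 <= Rabs c * k) by (apply Rmult_le_pos; lra).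
  assert (Hsk : 0 <= s * (2 * L + 2 * B)) by (apply Rmult_le_pos; lra).
  exists (1 + Rabs c * k + s * (2 * L + 2 * B)). split; [lra|].
  split.
  - intros q p t. unfold test_field, force_gap.
    replace (q + 1 + c) with (q + c + 1) by ring. now rewrite !HpF.
  - intros q p t Ht. unfold test_field.
    assert (R1 <= radius p t) by (unfold radius; generalize (Rabs_pos p); lra).
    rewrite log_cutoff_outside, bump_outside by lra. ring.
  - intros q q' p p' t t' Ht Ht'. unfold test_field.
    assert (H1 := log_cutoff_lipschitz R0 R1 1 p t p' t' ltac:(lra) ltac:(lra)
      (radius_ge_1 _ _) (radius_ge_1 _ _)).
    fold k in H1. rewrite Rinv_1, Rmult_1_l in H1.
    assert (H2 := bumped_gap_lipschitz u c R0 R1 B L q p t q' p' t' HB' HL' Ht Ht').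
    assert (H3 := radius_lipschitz p t p' t').
    set (g := log_cutoff R0 R1 p t) in *. set (g' := log_cutoff R0 R1 p' t') in *.
    set (h := force_gap u c q t * bump R0 p t) in *.
    set (h' := force_gap u c q' t' * bump R0 p' t') in *.
    replace (c * g' + s * h' - (c * g + s * h)) with (c * (g' - g) + s * (h' - h)) by ring.
    eapply Rle_trans; [apply Rabs_triang|]. rewrite !Rabs_mult, (Rabs_pos_eq s) by lra.
    assert (Dq := Rabs_pos (q' - q)). assert (Dp := Rabs_pos (p' - p)).
    assert (Dt := Rabs_pos (t' - t)).
    set (dq := Rabs (q' - q)) in *. set (dp := Rabs (p' - p)) in *.
    set (dt := Rabs (t' - t)) in *.
    assert (E1 : Rabs c * Rabs (g' - g) <= Rabs c * k * (dq + dp + dt)).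
    { rewrite Rmult_assoc. apply Rmult_le_compat_l; [lra|].
      eapply Rle_trans; [exact H1|]. apply Rmult_le_compat_l; lra. }
    assert (E2 : s * Rabs (h' - h) <= s * (2 * L + 2 * B) * (dq + dp + dt)).
    { rewrite Rmult_assoc. apply Rmult_le_compat_l; [lra|].
      eapply Rle_trans; [exact H2|]. nra. }
    lra.
Qed.

Lemma test_field_support (u : R -> R -> R) (c s R0 R1 q p t : R) :
  1 < R0 < R1 -> R1 <= Rabs p -> test_field u c s R0 R1 q p t = 0.
Proof.
  intros HR Hp. unfold test_field.
  assert (R1 <= radius p t) by (unfold radius; generalize (Rabs_pos t); lra).
  rewrite log_cutoff_outside, bump_outside by lra. ring.
Qed.

(** The bounds [B0] and [L0] concern the strip [|t| <= R0 + 1] only, so the constant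
    does not depend on [R1]: away from the bump, the correction
    vanishes both before and after the step. *)
Lemma bumped_gap_step (u : R -> R -> R) (c R0 B0 L0 B tau q p t : R) :
  1 < R0 -> 0 < B0 -> 0 < L0 -> 0 < B ->
  (forall q t, Rabs t <= R0 + 1 -> Rabs (partial1 u q t) <= B0) ->
  (forall x y t s, Rabs t <= R0 + 1 -> Rabs s <= R0 + 1 ->
    Rabs (partial1 u y s - partial1 u x t) <= L0 * (Rabs (y - x) + Rabs (s - t))) ->
  0 < tau -> tau * (1 + B) <= / 2 -> (forall q, Rabs (partial1 u q (t + tau)) <= B) ->
  let q' := q + tau * p in
  let p' := p - tau * partial1 u q' (t + tau) in
  (force_gap u c q' (t + tau) * bump R0 p' (t + tau) - force_gap u c q t * bump R0 p t) ^ 2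
  <= tau ^ 2 * (((2 * L0 * (R0 + 2) + 2 * B0 * (B0 + 1)) * (R0 + 1) ^ 2) ^ 2
      * (/ (1 + Rabs p) ^ 2 * / (1 + Rabs t) ^ 2)).
Proof.
  intros HR0 HB0 HL0 HB HFB0 HFL0 Htau HtB HFB q' p'.
  set (t' := t + tau) in *.
  assert (Ap := Rabs_pos p). assert (At := Rabs_pos t).
  set (C := 2 * L0 * (R0 + 2) + 2 * B0 * (B0 + 1)).
  assert (HC : 0 <= C).
  { unfold C. assert (0 < L0 * (R0 + 2)) by (apply Rmult_lt_0_compat; lra).
    assert (0 < B0 * (B0 + 1)) by (apply Rmult_lt_0_compat; lra). lra. }
  assert (Hdt : Rabs (t' - t) = tau).
  { unfold t'. replace (t + tau - t) with tau by ring. apply Rabs_pos_eq; lra. }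
  assert (Hdp : Rabs (p' - p) = tau * Rabs (partial1 u q' t')).
  { unfold p'. replace (p - tau * partial1 u q' t' - p) with (- (tau * partial1 u q' t')) by ring.
    rewrite Rabs_Ropp, Rabs_mult, (Rabs_pos_eq tau) by lra. reflexivity. }
  assert (Hdq : Rabs (q' - q) = tau * Rabs p).
  { unfold q'. replace (q + tau * p - q) with (tau * p) by ring.
    rewrite Rabs_mult, (Rabs_pos_eq tau) by lra. reflexivity. }
  assert (Hr := radius_lipschitz p t p' t').
  assert (Hdp' : Rabs (p' - p) <= tau * B).
  { rewrite Hdp. apply Rmult_le_compat_l; [lra|apply HFB]. }
  assert (Hr' : Rabs (radius p' t' - radius p t) <= 1) by lra.
  apply Rabs_le_between in Hr'.
  destruct (Rle_dec (radius p t) (R0 + 1)) as [Hin|Hout].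
  - destruct (Rle_dec (R0 + 1) (Rabs t')) as [Hbig|Hsmall].
    + rewrite (bump_outside R0 p' t') by (unfold radius; generalize (Rabs_pos p'); lra).
      assert (Htt : Rabs t' <= Rabs t + tau).
      { unfold t'. eapply Rle_trans; [apply Rabs_triang|]. rewrite (Rabs_pos_eq tau); lra. }
      rewrite (bump_outside R0 p t).
      2:{ unfold radius. assert (tau * B >= 0) by (apply Rle_ge, Rmult_le_pos; lra). lra. }
      rewrite !Rmult_0_r, Rminus_0_r.
      replace (0 ^ 2) with 0 by ring.
      apply Rmult_le_pos; [apply pow2_ge_0|]. apply Rmult_le_pos; [apply pow2_ge_0|].
      apply Rmult_le_pos; left; apply Rinv_0_lt_compat; apply pow_lt; lra.
    + assert (Hpt : Rabs p <= R0 /\ Rabs t <= R0) by (unfold radius in Hin; lra).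
      assert (Ht' : Rabs t' <= R0 + 1) by lra.
      assert (K := bumped_gap_lipschitz u c R0 (R0 + 1) B0 L0 q p t q' p' t' HFB0 HFL0
         ltac:(lra) Ht').
      assert (HF := HFB0 q' t' Ht').
      rewrite Hdq, Hdt, Hdp in K.
      set (D := force_gap u c q' t' * bump R0 p' t' - force_gap u c q t * bump R0 p t) in *.
      assert (K' : Rabs D <= tau * C).
      { eapply Rle_trans; [exact K|]. unfold C.
        assert (tau * (L0 * Rabs p) <= tau * (L0 * (R0 + 1))).
        { apply Rmult_le_compat_l; [lra|]. apply Rmult_le_compat_l; lra. }
        assert (tau * (B0 * Rabs (partial1 u q' t')) <= tau * (B0 * B0)).
        { apply Rmult_le_compat_l; [lra|]. apply Rmult_le_compat_l; lra. }
        lra. }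
      assert (K2 : D ^ 2 <= (tau * C) ^ 2).
      { rewrite <- (pow2_abs D). apply pow_incr. split; [apply Rabs_pos|exact K']. }
      eapply Rle_trans; [exact K2|].
      assert (W1 : 1 <= (R0 + 1) ^ 2 * / (1 + Rabs p) ^ 2).
      { apply (Rmult_le_reg_r ((1 + Rabs p) ^ 2)); [apply pow_lt; lra|].
        rewrite Rmult_assoc, Rinv_l by (apply pow_nonzero; lra).
        rewrite Rmult_1_l, Rmult_1_r. apply pow_incr; lra. }
      assert (W2 : 1 <= (R0 + 1) ^ 2 * / (1 + Rabs t) ^ 2).
      { apply (Rmult_le_reg_r ((1 + Rabs t) ^ 2)); [apply pow_lt; lra|].
        rewrite Rmult_assoc, Rinv_l by (apply pow_nonzero; lra).
        rewrite Rmult_1_l, Rmult_1_r. apply pow_incr; lra. }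
      set (w1 := / (1 + Rabs p) ^ 2) in *. set (w2 := / (1 + Rabs t) ^ 2) in *.
      replace (tau ^ 2 * ((C * (R0 + 1) ^ 2) ^ 2 * (w1 * w2)))
        with ((tau * C) ^ 2 * (((R0 + 1) ^ 2 * w1) * ((R0 + 1) ^ 2 * w2))) by ring.
      rewrite <- (Rmult_1_r ((tau * C) ^ 2)) at 1.
      apply Rmult_le_compat_l; [apply pow2_ge_0|].
      rewrite <- (Rmult_1_r 1) at 1. apply Rmult_le_compat; lra.
  - rewrite (bump_outside R0 p t), (bump_outside R0 p' t') by lra.
    rewrite !Rmult_0_r, Rminus_0_r. replace (0 ^ 2) with 0 by ring.
    apply Rmult_le_pos; [apply pow2_ge_0|]. apply Rmult_le_pos; [apply pow2_ge_0|].
    apply Rmult_le_pos; left; apply Rinv_0_lt_compat; apply pow_lt; lra.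
Qed.

(** The step is so short that the radius changes by at most 1/2, hence by at most
    a factor 2. *)
Lemma log_cutoff_step (F : R -> R -> R) (R0 R1 B tau q p t : R) :
  0 < R0 < R1 -> 0 < B -> 0 < tau -> tau * (1 + B) <= / 2 ->
  (forall q, Rabs (F q (t + tau)) <= B) ->
  let f := F (q + tau * p) (t + tau) in
  (log_cutoff R0 R1 (p - tau * f) (t + tau) - log_cutoff R0 R1 p t) ^ 2
  <= tau ^ 2 * (8 / (ln R1 - ln R0) ^ 2 * (1 + f ^ 2) * / radius p t ^ 2).
Proof.
  intros HR HB Htau HtB HFB f.
  assert (Hf : Rabs f <= B) by apply HFB.
  assert (Hr1 := radius_ge_1 p t).
  assert (Hr : Rabs (radius (p - tau * f) (t + tau) - radius p t) <= tau * (1 + Rabs f)).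
  { eapply Rle_trans; [apply radius_lipschitz|].
    replace (p - tau * f - p) with (- (tau * f)) by ring.
    replace (t + tau - t) with tau by ring.
    rewrite Rabs_Ropp, Rabs_mult, (Rabs_pos_eq tau) by lra. lra. }
  assert (Hsm : tau * (1 + Rabs f) <= / 2).
  { eapply Rle_trans; [|exact HtB]. apply Rmult_le_compat_l; lra. }
  assert (Hr' := Hr). apply Rabs_le_between in Hr'.
  assert (K := log_cutoff_lipschitz R0 R1 (radius p t / 2) p t (p - tau * f) (t + tau) HR
     ltac:(lra) ltac:(lra) ltac:(lra)).
  assert (HLn : 0 < ln R1 - ln R0).
  { assert (ln R0 < ln R1) by (apply ln_increasing; lra). lra. }
  set (D := log_cutoff R0 R1 (p - tau * f) (t + tau) - log_cutoff R0 R1 p t) in *.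
  set (r := radius p t) in *. set (l := ln R1 - ln R0) in *.
  assert (Hl : 0 < / l) by now apply Rinv_0_lt_compat.
  assert (Hri : 0 < / (r / 2)) by (apply Rinv_0_lt_compat; lra).
  assert (K' : Rabs D <= / l * (/ (r / 2) * (tau * (1 + Rabs f)))).
  { eapply Rle_trans; [exact K|]. apply Rmult_le_compat_l; [lra|].
    apply Rmult_le_compat_l; lra. }
  apply Rle_trans with ((/ l * (/ (r / 2) * (tau * (1 + Rabs f)))) ^ 2).
  { rewrite <- (pow2_abs D). apply pow_incr. split; [apply Rabs_pos|exact K']. }
  replace ((/ l * (/ (r / 2) * (tau * (1 + Rabs f)))) ^ 2)
    with (tau ^ 2 * (4 / l ^ 2 * (1 + Rabs f) ^ 2 * / r ^ 2)) by (field; lra).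
  apply Rmult_le_compat_l; [apply pow2_ge_0|].
  apply Rmult_le_compat_r; [left; apply Rinv_0_lt_compat, pow_lt; lra|].
  replace (8 / l ^ 2 * (1 + f ^ 2)) with (4 / l ^ 2 * (2 * (1 + f ^ 2))) by (field; lra).
  apply Rmult_le_compat_l.
  { apply Rmult_le_pos; [lra|]. left; apply Rinv_0_lt_compat, pow_lt; lra. }
  rewrite <- (pow2_abs f). assert (0 <= (1 - Rabs f) ^ 2) by apply pow2_ge_0. nra.
Qed.

(** Expanding [u] at [q + c], where the slope of the potential excess is exactly the force gap. The
    condition [s L0 <= 1/2] absorbs the second-order term into half of the first-order
    gain. *)
Lemma potential_excess_test (u : R -> R -> R) (c s R0 R1 L0 q p t : R) :
  class_C_2d 1 u -> R0 < R1 -> 0 <= s -> 0 < L0 -> s * L0 <= / 2 ->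
  (forall x y t, Rabs t <= R0 -> Rabs (partial1 u y t - partial1 u x t) <= L0 * Rabs (y - x)) ->
  potential_excess u q t (c * log_cutoff R0 R1 p t)
    + / 2 * s * bump R0 p t * force_gap u c q t ^ 2
  <= potential_excess u q t (test_field u c s R0 R1 q p t).
Proof.
  intros Hu HR Hs HL HsL HFL. unfold test_field.
  assert (Hb := clamp_bounds (R0 - radius p t)). fold (bump R0 p t) in Hb.
  destruct (Rle_dec R0 (radius p t)) as [Hout|Hin].
  - rewrite (bump_outside R0 p t Hout).
    replace (s * (force_gap u c q t * 0)) with 0 by ring. rewrite Rplus_0_r. lra.
  - rewrite log_cutoff_inside by lra. rewrite Rmult_1_r.
    assert (Ht : Rabs t <= R0) by (unfold radius in Hin; generalize (Rabs_pos p); lra).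
    set (b := bump R0 p t) in *. set (h := s * (force_gap u c q t * b)).
    unfold potential_excess.
    destruct (MVT_derive (fun z => u z t) (fun z => partial1 u z t) (q + c) (q + (c + h)))
      as [y [Hy Ey]]. { intros; now apply C1_derive1. }
    assert (Hd := between_dist _ _ _ Hy).
    replace (q + (c + h) - (q + c)) with h in Ey, Hd by ring.
    assert (Hl := HFL (q + c) y t Ht).
    assert (Hlh : Rabs (partial1 u y t - partial1 u (q + c) t) <= L0 * Rabs h).
    { eapply Rle_trans; [exact Hl|]. apply Rmult_le_compat_l; lra. }
    assert (Hq : - (L0 * h ^ 2) <= (partial1 u y t - partial1 u (q + c) t) * h).
    { assert (Hm : Rabs ((partial1 u y t - partial1 u (q + c) t) * h) <= L0 * h ^ 2).
      { rewrite Rabs_mult, <- (pow2_abs h).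
        replace (L0 * Rabs h ^ 2) with (L0 * Rabs h * Rabs h) by ring.
        apply Rmult_le_compat_r; [apply Rabs_pos|exact Hlh]. }
      apply Rabs_le_between in Hm. lra. }
    assert (Hg : force_gap u c q t = partial1 u (q + c) t - partial1 u q t) by reflexivity.
    set (G := force_gap u c q t) in *.
    assert (HLh : L0 * h ^ 2 <= / 2 * s * b * G ^ 2).
    { unfold h. replace (L0 * (s * (G * b)) ^ 2) with ((s * L0) * (s * (b * b) * G ^ 2)) by ring.
      assert (HG := pow2_ge_0 G).
      assert (Hsb : 0 <= s * (b * b) * G ^ 2).
      { apply Rmult_le_pos; [|exact HG]. apply Rmult_le_pos; [lra|]. apply Rmult_le_pos; lra. }
      assert (Hbb : s * (b * b) * G ^ 2 <= s * b * G ^ 2).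
      { apply Rmult_le_compat_r; [exact HG|]. apply Rmult_le_compat_l; [lra|]. nra. }
      assert (s * L0 * (s * (b * b) * G ^ 2) <= / 2 * (s * (b * b) * G ^ 2))
        by (apply Rmult_le_compat_r; lra).
      lra. }
    assert (Hh : G * h = s * b * G ^ 2) by (unfold h; ring).
    assert (Ey' : u (q + (c + h)) t - u (q + c) t
      = (partial1 u y t - partial1 u (q + c) t) * h + (G + partial1 u q t) * h)
      by (rewrite Ey; rewrite Hg; ring).
    lra.
Qed.

(** The pointwise bound whose four terms are the energy of the cutoff, the
    quadratic cost of the correction, the potential excess of the cutoff, of
    mean zero, and the first-order gain. *)
Lemma variation_test_upper (u : R -> R -> R) (c s R0 R1 B0 L0 B tau t q p : R) :
  class_C_2d 1 u -> 1 < R0 < R1 -> 0 <= s -> 0 < B0 -> 0 < L0 -> 0 < B -> s * L0 <= / 2 ->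
  (forall q t, Rabs t <= R0 + 1 -> Rabs (partial1 u q t) <= B0) ->
  (forall x y t s, Rabs t <= R0 + 1 -> Rabs s <= R0 + 1 ->
    Rabs (partial1 u y s - partial1 u x t) <= L0 * (Rabs (y - x) + Rabs (s - t))) ->
  0 < tau -> tau * (1 + B) <= / 2 -> (forall q, Rabs (partial1 u q (t + tau)) <= B) ->
  let C := ((2 * L0 * (R0 + 2) + 2 * B0 * (B0 + 1)) * (R0 + 1) ^ 2) ^ 2 in
  variation u tau (test_field u c s R0 R1) t q p
  <= tau * ( 8 * c ^ 2 / (ln R1 - ln R0) ^ 2 * / radius p t ^ 2
               * (1 + partial1 u (q + tau * p) (t + tau) ^ 2)
           + s ^ 2 * C * (/ (1 + Rabs p) ^ 2 * / (1 + Rabs t) ^ 2)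
           - potential_excess u q t (c * log_cutoff R0 R1 p t)
           - / 2 * s * bump R0 p t * force_gap u c q t ^ 2).
Proof.
  intros Hu HR Hs HB0 HL0 HB HsL HFB0 HFL0 Htau HtB HFB C.
  assert (K1 := log_cutoff_step (partial1 u) R0 R1 B tau q p t ltac:(lra) HB Htau HtB HFB).
  assert (K2 := bumped_gap_step u c R0 B0 L0 B tau q p t ltac:(lra) HB0 HL0 HB HFB0 HFL0
     Htau HtB HFB).
  assert (K3 := potential_excess_test u c s R0 R1 L0 q p t Hu ltac:(lra) Hs HL0 HsL).
  cbv zeta in K1, K2. fold C in K2.
  assert (K3' : potential_excess u q t (c * log_cutoff R0 R1 p t)
    + / 2 * s * bump R0 p t * force_gap u c q t ^ 2
    <= potential_excess u q t (test_field u c s R0 R1 q p t)).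
  { apply K3. intros x y t0 Ht0.
    replace (Rabs (y - x)) with (Rabs (y - x) + Rabs (t0 - t0))
      by (rewrite Rminus_diag, Rabs_R0; ring).
    apply HFL0; lra. }
  clear K3. unfold variation. cbv zeta.
  set (f := partial1 u (q + tau * p) (t + tau)) in *.
  unfold test_field at 1 2.
  set (g' := log_cutoff R0 R1 (p - tau * f) (t + tau)) in *.
  set (g := log_cutoff R0 R1 p t) in *.
  set (h' := force_gap u c (q + tau * p) (t + tau) * bump R0 (p - tau * f) (t + tau)) in *.
  set (h := force_gap u c q t * bump R0 p t) in *.
  set (e1 := potential_excess u q t (test_field u c s R0 R1 q p t)) in *.
  set (e2 := potential_excess u q t (c * g)) in *.
  set (e3 := / 2 * s * bump R0 p t * force_gap u c q t ^ 2) in *.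
  assert (Hl : ln R0 < ln R1) by (apply ln_increasing; lra).
  assert (Hr := radius_ge_1 p t).
  set (W := / (1 + Rabs p) ^ 2 * / (1 + Rabs t) ^ 2) in *.
  set (r := radius p t) in *. set (l := ln R1 - ln R0) in *.
  assert (Hsq : (c * g' + s * h' - (c * g + s * h)) ^ 2
     <= 2 * c ^ 2 * (g' - g) ^ 2 + 2 * s ^ 2 * (h' - h) ^ 2).
  { assert (0 <= (c * (g' - g) - s * (h' - h)) ^ 2) by apply pow2_ge_0. lra. }
  assert (Hc2 := pow2_ge_0 c). assert (Hs2 := pow2_ge_0 s).
  assert (M1 : 2 * c ^ 2 * (g' - g) ^ 2
     <= 2 * c ^ 2 * (tau ^ 2 * (8 / l ^ 2 * (1 + f ^ 2) * / r ^ 2)))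
    by (apply Rmult_le_compat_l; lra).
  assert (M2 : 2 * s ^ 2 * (h' - h) ^ 2 <= 2 * s ^ 2 * (tau ^ 2 * (C * W)))
    by (apply Rmult_le_compat_l; lra).
  assert (M3 : (c * g' + s * h' - (c * g + s * h)) ^ 2 / (2 * tau)
    <= tau * (8 * c ^ 2 / l ^ 2 * / r ^ 2 * (1 + f ^ 2) + s ^ 2 * C * W)).
  { apply (Rmult_le_reg_r (2 * tau)); [lra|].
    unfold Rdiv at 1. rewrite Rmult_assoc, Rinv_l, Rmult_1_r by lra.
    replace (tau * (8 * c ^ 2 / l ^ 2 * / r ^ 2 * (1 + f ^ 2) + s ^ 2 * C * W) * (2 * tau))
      with (2 * c ^ 2 * (tau ^ 2 * (8 / l ^ 2 * (1 + f ^ 2) * / r ^ 2))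
           + 2 * s ^ 2 * (tau ^ 2 * (C * W))) by (field; unfold l; lra).
    lra. }
  assert (M4 : tau * (e2 + e3) <= tau * e1) by (apply Rmult_le_compat_l; lra).
  lra.
Qed.

(** * One-dimensional integrals *)

Lemma ex_RInt_cont (h : R -> R) (a b : R) : (forall x, continuous h x) -> ex_RInt h a b.
Proof.
  intros H. apply (ex_RInt_continuous (V := R_CompleteNormedModule)). intros; apply H.
Qed.

Lemma RInt_cst (c a b : R) : RInt (fun _ => c) a b = (b - a) * c.
Proof. rewrite RInt_const. reflexivity. Qed.

Lemma RInt_cst_eq (c a b v : R) : v = (b - a) * c -> RInt (fun _ => c) a b = v.
Proof. intros ->. apply RInt_cst. Qed.

Lemma RInt_scal_R (h : R -> R) (k a b : R) :
  (forall x, continuous h x) -> RInt (fun x => k * h x) a b = k * RInt h a b.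
Proof.
  intros H. apply (RInt_scal (V := R_CompleteNormedModule) h). now apply ex_RInt_cont.
Qed.

Lemma RInt_plus_R (g h : R -> R) (a b : R) :
  (forall x, continuous g x) -> (forall x, continuous h x) ->
  RInt (fun x => g x + h x) a b = RInt g a b + RInt h a b.
Proof.
  intros H1 H2. apply (RInt_plus (V := R_CompleteNormedModule) g h); now apply ex_RInt_cont.
Qed.

Lemma continuous_plus_R (g h : R -> R) (x : R) :
  continuous g x -> continuous h x -> continuous (fun x => g x + h x) x.
Proof. intros H1 H2. now apply (continuous_plus (V := R_NormedModule) g h). Qed.

Lemma continuous_scal_R (h : R -> R) (k x : R) :
  continuous h x -> continuous (fun x => k * h x) x.
Proof. intros H. now apply (continuous_scal_r (V := R_NormedModule) k h). Qed.

Lemma RInt_linear3 (h1 h2 h3 : R -> R) (k1 k2 k3 a b : R) :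
  (forall x, continuous h1 x) -> (forall x, continuous h2 x) -> (forall x, continuous h3 x) ->
  RInt (fun x => k1 * h1 x + k2 * h2 x + k3 * h3 x) a b
  = k1 * RInt h1 a b + k2 * RInt h2 a b + k3 * RInt h3 a b.
Proof.
  intros H1 H2 H3.
  rewrite (RInt_plus_R (fun x => k1 * h1 x + k2 * h2 x) (fun x => k3 * h3 x)).
  - rewrite (RInt_plus_R (fun x => k1 * h1 x) (fun x => k2 * h2 x)).
    + now rewrite !RInt_scal_R.
    + intros; now apply continuous_scal_R.
    + intros; now apply continuous_scal_R.
  - intros; apply continuous_plus_R; now apply continuous_scal_R.
  - intros; now apply continuous_scal_R.
Qed.

Lemma continuous_linear3 (h1 h2 h3 : R -> R) (k1 k2 k3 x : R) :
  continuous h1 x -> continuous h2 x -> continuous h3 x ->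
  continuous (fun x => k1 * h1 x + k2 * h2 x + k3 * h3 x) x.
Proof.
  intros. repeat apply continuous_plus_R; now apply continuous_scal_R.
Qed.

Lemma RInt_le_cont (g h : R -> R) (a b : R) :
  a <= b -> (forall x, continuous g x) -> (forall x, continuous h x) ->
  (forall x, a <= x <= b -> g x <= h x) -> RInt g a b <= RInt h a b.
Proof.
  intros Hab Hg Hh H. apply RInt_le; [exact Hab|now apply ex_RInt_cont|now apply ex_RInt_cont|].
  intros x Hx; apply H; lra.
Qed.

Lemma RInt_nonneg (h : R -> R) (a b : R) :
  a <= b -> (forall x, continuous h x) -> (forall x, 0 <= h x) -> 0 <= RInt h a b.
Proof.
  intros Hab Hc H. replace 0 with (RInt (fun _ => 0) a b) by (apply RInt_cst_eq; ring).
  apply RInt_le_cont; auto. intros; apply continuous_const.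
Qed.

Lemma RInt_restrict (h : R -> R) (a b c d : R) :
  a <= c -> c <= d -> d <= b -> (forall x, continuous h x) -> (forall x, 0 <= h x) ->
  RInt h c d <= RInt h a b.
Proof.
  intros H1 H2 H3 Hc Hp.
  rewrite (RInt_Chasles_continuous h a c b Hc), (RInt_Chasles_continuous h c d b Hc).
  assert (K1 := RInt_nonneg h a c H1 Hc Hp). assert (K2 := RInt_nonneg h d b H3 Hc Hp).
  lra.
Qed.

Lemma RInt_positive (h : R -> R) (x0 : R) :
  (forall x, continuous h x) -> (forall x, 0 <= h x) -> (forall x, h (x + 1) = h x) ->
  0 < h x0 -> 0 < RInt h 0 1.
Proof.
  intros Hc Hp Hper Hx0.
  (* move the point where h is positive to the middle of the period *)
  rewrite <- (RInt_period h (x0 - / 2) Hc Hper).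
  set (g := fun x => h (x + (x0 - / 2))).
  assert (Hgc : forall x, continuous g x).
  { intros x. apply (continuous_comp (fun x => x + (x0 - / 2)) h); [|apply Hc].
    apply (continuous_plus (V := R_NormedModule)); [apply continuous_id|apply continuous_const]. }
  assert (Hg : 0 < g (/ 2)) by (unfold g; replace (/ 2 + (x0 - / 2)) with x0 by ring; exact Hx0).
  destruct (proj1 (filterlim_locally g _) (Hgc (/ 2)) (mkposreal (g (/ 2) / 2) ltac:(lra)))
    as [d Hd]. simpl in Hd.
  set (e := Rmin (d / 2) (/ 2)). assert (Hd0 := cond_pos d).
  assert (He : 0 < e) by (apply Rmin_pos; lra).
  assert (He1 : e <= d / 2) by apply Rmin_l. assert (He2 : e <= / 2) by apply Rmin_r.
  apply Rlt_le_trans with (RInt g (/ 2 - e) (/ 2 + e)).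
  - apply Rlt_le_trans with (RInt (fun _ => g (/ 2) / 2) (/ 2 - e) (/ 2 + e)).
    + rewrite RInt_cst. apply Rmult_lt_0_compat; lra.
    + apply RInt_le_cont; [lra|intros; apply continuous_const|exact Hgc|].
      intros x Hx. assert (Hb : ball (/ 2) d x).
      { change (Rabs (x - / 2) < d). apply Rabs_lt_between. lra. }
      specialize (Hd x Hb). change (Rabs (g x - g (/ 2)) < g (/ 2) / 2) in Hd.
      apply Rabs_lt_between in Hd. lra.
  - apply RInt_restrict; try lra; [exact Hgc|]. intros; apply Hp.
Qed.

Lemma lipschitz_continuous (h : R -> R) (L : R) :
  0 < L -> (forall x y, Rabs (h y - h x) <= L * Rabs (y - x)) -> forall x, continuous h x.
Proof.
  intros HL H x. apply filterlim_locally. intros [e He].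
  assert (Hd : 0 < e / L) by (apply Rdiv_lt_0_compat; lra).
  exists (mkposreal _ Hd). intros y Hy.
  change (Rabs (y - x) < e / L) in Hy. change (Rabs (h y - h x) < e).
  eapply Rle_lt_trans; [apply H|].
  apply (Rmult_lt_compat_l L) in Hy; [|lra].
  replace (L * (e / L)) with e in Hy by (field; lra). exact Hy.
Qed.

Lemma continuous_inv_pow_abs (a : R) (n : nat) (x : R) :
  0 < a -> continuous (fun x => / (a + Rabs x) ^ n) x.
Proof.
  intros Ha. apply (continuous_comp (fun x => a + Rabs x) (fun r => / r ^ n)).
  - apply (lipschitz_continuous _ 1); [lra|]. intros y z.
    replace (a + Rabs z - (a + Rabs y)) with (Rabs z - Rabs y) by ring.
    rewrite Rmult_1_l. apply Rabs_triang_inv2.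
  - apply (ex_derive_continuous (fun r => / r ^ n)).
    auto_derive. apply pow_nonzero. generalize (Rabs_pos x); lra.
Qed.

Lemma RInt_even (h : R -> R) (T : R) :
  (forall x, continuous h x) -> (forall x, h (- x) = h x) ->
  RInt h (- T) T = 2 * RInt h 0 T.
Proof.
  intros Hc He. rewrite (RInt_Chasles_continuous h (- T) 0 T Hc).
  assert (E : RInt h (- T) 0 = RInt h 0 T).
  { assert (E1 := RInt_comp_lin (V := R_CompleteNormedModule) h (-1) 0 T 0
      (ex_RInt_cont h _ _ Hc)).
    replace (-1 * T + 0) with (- T) in E1 by ring. replace (-1 * 0 + 0) with 0 in E1 by ring.
    rewrite <- E1, (RInt_ext _ (fun y => -1 * h y)).
    - rewrite RInt_scal_R by exact Hc.
      assert (E2 := RInt_Chasles_continuous h T 0 T Hc).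
      assert (E3 : RInt h T T = 0) by apply (RInt_point (V := R_CompleteNormedModule)).
      rewrite E3 in E2. change (-1 * RInt h T 0 = RInt h 0 T). lra.
    - intros x _. rewrite <- He. unfold scal; simpl; unfold mult; simpl.
      do 2 f_equal. ring. }
  rewrite E. change (RInt h 0 T + RInt h 0 T = 2 * RInt h 0 T). ring.
Qed.

Lemma RInt_inv_sqr_abs (a P : R) :
  0 < a -> 0 <= P -> RInt (fun p => / (a + Rabs p) ^ 2) (- P) P <= 2 / a.
Proof.
  intros Ha HP.
  rewrite (RInt_even (fun p => / (a + Rabs p) ^ 2)).
  - replace (RInt (fun p => / (a + Rabs p) ^ 2) 0 P) with (/ a - / (a + P)).
    + assert (0 < / (a + P)) by (apply Rinv_0_lt_compat; lra). unfold Rdiv. lra.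
    + symmetry. apply is_RInt_unique.
      replace (/ a - / (a + P)) with (minus (- / (a + P)) (- / (a + 0)))
        by (unfold minus, plus, opp; simpl; rewrite Rplus_0_r; ring).
      apply (is_RInt_ext (fun p => / (a + p) ^ 2)).
      { intros x Hx. rewrite Rmin_left in Hx by lra. now rewrite Rabs_pos_eq by lra. }
      apply (is_RInt_derive (V := R_CompleteNormedModule) (fun p => - / (a + p))).
      * intros x Hx. rewrite Rmin_left in Hx by lra. auto_derive; [lra|field; lra].
      * intros x Hx. rewrite Rmin_left in Hx by lra.
        apply (ex_derive_continuous (fun p => / (a + p) ^ 2)). auto_derive.
        apply (pow_nonzero (a + x) 2). lra.
  - intros; now apply continuous_inv_pow_abs.
  - intros; now rewrite Rabs_Ropp.
Qed.

Lemma RInt_inv_abs (T : R) :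
  0 <= T -> RInt (fun p => / (1 + Rabs p)) (- T) T = 2 * ln (1 + T).
Proof.
  intros HT.
  rewrite (RInt_even (fun p => / (1 + Rabs p))).
  - f_equal. apply is_RInt_unique.
    replace (ln (1 + T)) with (minus (ln (1 + T)) (ln (1 + 0)))
      by (unfold minus, plus, opp; simpl; rewrite Rplus_0_r, ln_1; ring).
    apply (is_RInt_ext (fun p => / (1 + p))).
    { intros x Hx. rewrite Rmin_left in Hx by lra. now rewrite Rabs_pos_eq by lra. }
    apply (is_RInt_derive (V := R_CompleteNormedModule) (fun p => ln (1 + p))).
    + intros x Hx. rewrite Rmin_left in Hx by lra. auto_derive; [lra|field; lra].
    + intros x Hx. rewrite Rmin_left in Hx by lra.
      apply (ex_derive_continuous (fun p => / (1 + p))). auto_derive. lra.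
  - intros x. apply (continuous_ext (fun x => / (1 + Rabs x) ^ 1)).
    { intros; now rewrite pow_1. } apply continuous_inv_pow_abs; lra.
  - intros; now rewrite Rabs_Ropp.
Qed.

(** ** Comparison of time sums with integrals *)

Lemma sum_RInt_time (w : R -> R) (T tau : R) (N : nat) :
  (forall x, continuous w x) -> INR N * tau = T ->
  sum_below (fun n => RInt w (time T tau n) (time T tau n + tau)) (2 * N) = RInt w (- T) T.
Proof.
  intros Hw HN.
  replace (RInt w (- T) T) with (RInt w (time T tau 0) (time T tau (2 * N)))
    by (now rewrite time_0, time_end).
  generalize (2 * N)%nat as m. induction m as [|m IH]; cbn [sum_below].
  - symmetry. apply (RInt_point (V := R_CompleteNormedModule)).
  - rewrite IH, <- time_S. symmetry. now apply RInt_Chasles_continuous.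
Qed.

Lemma sum_time_le (w a : R -> R) (T tau : R) (N : nat) :
  (forall x, continuous w x) -> INR N * tau = T -> 0 < tau ->
  (forall t x, t <= x <= t + tau -> a t <= w x) ->
  sum_below (fun n => tau * a (time T tau n)) (2 * N) <= RInt w (- T) T.
Proof.
  intros Hw HN Ht H. rewrite <- (sum_RInt_time w T tau N Hw HN).
  apply sum_below_le. intros k _. set (t := time T tau k).
  replace (tau * a t) with (RInt (fun _ => a t) t (t + tau)) by (apply RInt_cst_eq; ring).
  apply RInt_le_cont; [lra|intros; apply continuous_const|exact Hw|]. auto.
Qed.

Lemma sum_time_ge (w a : R -> R) (T tau : R) (N : nat) :
  (forall x, continuous w x) -> INR N * tau = T -> 0 < tau ->
  (forall t x, t <= x <= t + tau -> w x <= a t) ->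
  RInt w (- T) T <= sum_below (fun n => tau * a (time T tau n)) (2 * N).
Proof.
  intros Hw HN Ht H. rewrite <- (sum_RInt_time w T tau N Hw HN).
  apply sum_below_le. intros k _. set (t := time T tau k).
  replace (tau * a t) with (RInt (fun _ => a t) t (t + tau)) by (apply RInt_cst_eq; ring).
  apply RInt_le_cont; [lra|exact Hw|intros; apply continuous_const|]. auto.
Qed.

(** Within one step, [1 + |t|] changes at most by a factor 2. *)
Lemma inv_pow_step (tau t x : R) (n : nat) :
  0 < tau <= 1 -> t <= x <= t + tau ->
  / (1 + Rabs t) ^ n <= 2 ^ n * / (1 + Rabs x) ^ n.
Proof.
  intros Ht Hx. assert (At := Rabs_pos t). assert (Ax := Rabs_pos x).
  assert (H : 1 + Rabs x <= 2 * (1 + Rabs t)).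
  { replace x with (t + (x - t)) by ring. generalize (Rabs_triang t (x - t)).
    rewrite (Rabs_pos_eq (x - t)) by lra. lra. }
  assert (Hp : (1 + Rabs x) ^ n <= 2 ^ n * (1 + Rabs t) ^ n).
  { rewrite <- Rpow_mult_distr. apply pow_incr. lra. }
  assert (P1 : 0 < (1 + Rabs x) ^ n) by (apply pow_lt; lra).
  assert (P2 : 0 < (1 + Rabs t) ^ n) by (apply pow_lt; lra).
  apply (Rmult_le_reg_r ((1 + Rabs x) ^ n * (1 + Rabs t) ^ n)).
  { apply Rmult_lt_0_compat; assumption. }
  replace (/ (1 + Rabs t) ^ n * ((1 + Rabs x) ^ n * (1 + Rabs t) ^ n)) with ((1 + Rabs x) ^ n)
    by (field; lra).
  replace (2 ^ n * / (1 + Rabs x) ^ n * ((1 + Rabs x) ^ n * (1 + Rabs t) ^ n))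
    with (2 ^ n * (1 + Rabs t) ^ n) by (field; lra). exact Hp.
Qed.

Lemma sum_inv_time (T tau : R) (N : nat) :
  0 < T -> INR N * tau = T -> 0 < tau <= 1 ->
  sum_below (fun n => tau * / (1 + Rabs (time T tau n))) (2 * N) <= 4 * ln (1 + T).
Proof.
  intros HT HN Ht.
  assert (Hc : forall x, continuous (fun x => / (1 + Rabs x)) x).
  { intros x. apply (continuous_ext (fun x => / (1 + Rabs x) ^ 1)).
    { intros; now rewrite pow_1. } apply continuous_inv_pow_abs; lra. }
  assert (E : 4 * ln (1 + T) = RInt (fun x => 2 * / (1 + Rabs x)) (- T) T).
  { rewrite RInt_scal_R by exact Hc. rewrite RInt_inv_abs by lra. ring. }
  rewrite E.
  apply (sum_time_le _ (fun t => / (1 + Rabs t))); try lra; [|].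
  - intros; now apply continuous_scal_R.
  - intros t x Hx. assert (K := inv_pow_step tau t x 1 Ht Hx). now rewrite !pow_1 in K.
Qed.

Lemma sum_inv_sqr_time (T tau : R) (N : nat) :
  0 < T -> INR N * tau = T -> 0 < tau <= 1 ->
  sum_below (fun n => tau * / (1 + Rabs (time T tau n)) ^ 2) (2 * N) <= 8.
Proof.
  intros HT HN Ht.
  assert (Hc : forall x, continuous (fun x => / (1 + Rabs x) ^ 2) x)
    by (intros; apply continuous_inv_pow_abs; lra).
  apply Rle_trans with (RInt (fun x => 4 * / (1 + Rabs x) ^ 2) (- T) T).
  - apply (sum_time_le _ (fun t => / (1 + Rabs t) ^ 2)); try lra; [|].
    + intros; now apply continuous_scal_R.
    + intros t x Hx. assert (K := inv_pow_step tau t x 2 Ht Hx).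
      replace (2 ^ 2) with 4 in K by ring. exact K.
  - rewrite RInt_scal_R by exact Hc. assert (K := RInt_inv_sqr_abs 1 T ltac:(lra) ltac:(lra)).
    lra.
Qed.

(** A tent at [t0], equal to 1 at distance at most [d/4] and to 0 beyond distance
    [d/2]. *)
Definition tent (t0 d x : R) : R := clamp (2 - 4 / d * Rabs (x - t0)).

Lemma tent_continuous (t0 d x : R) : 0 < d -> continuous (tent t0 d) x.
Proof.
  intros Hd. assert (Hd4 : 0 < 4 / d) by (apply Rdiv_lt_0_compat; lra).
  apply (lipschitz_continuous _ (4 / d)); [exact Hd4|]. intros y z. unfold tent.
  eapply Rle_trans; [apply clamp_lipschitz|].
  replace (2 - 4 / d * Rabs (z - t0) - (2 - 4 / d * Rabs (y - t0)))
    with (4 / d * - (Rabs (z - t0) - Rabs (y - t0))) by ring.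
  rewrite Rabs_mult, Rabs_Ropp, (Rabs_pos_eq (4 / d)) by lra.
  apply Rmult_le_compat_l; [lra|].
  replace (z - y) with (z - t0 - (y - t0)) by ring. apply Rabs_triang_inv2.
Qed.

Lemma tent_integral (t0 d T : R) :
  0 < d <= 1 -> Rabs t0 + 1 <= T -> d / 2 <= RInt (tent t0 d) (- T) T.
Proof.
  intros Hd HT. assert (H0 : Rabs t0 <= T - 1) by lra. apply Rabs_le_between in H0.
  assert (Hc : forall x, continuous (tent t0 d) x) by (intros; apply tent_continuous; lra).
  apply Rle_trans with (RInt (tent t0 d) (t0 - d / 4) (t0 + d / 4)).
  - replace (d / 2) with (RInt (fun _ => 1) (t0 - d / 4) (t0 + d / 4)) by (apply RInt_cst_eq; field).
    apply RInt_le_cont; [lra|intros; apply continuous_const|exact Hc|].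
    intros x Hx. unfold tent. rewrite clamp_1; [lra|].
    assert (Ha : Rabs (x - t0) <= d / 4) by (apply Rabs_le_between; lra).
    assert (4 / d * Rabs (x - t0) <= 4 / d * (d / 4)).
    { apply Rmult_le_compat_l; [|exact Ha]. left; apply Rdiv_lt_0_compat; lra. }
    replace (4 / d * (d / 4)) with 1 in H by (field; lra). lra.
  - apply RInt_restrict; try lra; [exact Hc|]. intros; apply clamp_bounds.
Qed.

(** * The mean variation along the test field *)

(** The mean square over one period of the force gap at time [t]. *)
Definition gap_energy (u : R -> R -> R) (c t : R) : R :=
  RInt (fun q => force_gap u c q t ^ 2) 0 1.

Lemma force_mean_zero (u : R -> R -> R) (t : R) :
  class_C_2d 1 u -> periodic1 u -> RInt (fun q => partial1 u q t) 0 1 = 0.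
Proof.
  intros Hu Hp. apply is_RInt_unique.
  replace 0 with (minus (u 1 t) (u 0 t)) at 2.
  - apply (is_RInt_derive (V := R_CompleteNormedModule) (fun q => u q t)).
    + intros; now apply C1_derive1.
    + intros; apply continuous2_1; now apply C1_partial1.
  - unfold minus, plus, opp; simpl. replace 1 with (0 + 1) by ring. rewrite Hp. ring.
Qed.

Lemma continuous_shift2 (g : R -> R -> R) (s t x : R) :
  continuous2 g -> continuous (fun x => g (x + s) t) x.
Proof.
  intros Hg. apply (continuous_comp (fun x => x + s) (fun y => g y t)).
  - apply (continuous_plus (V := R_NormedModule)); [apply continuous_id|apply continuous_const].
  - now apply continuous2_1.
Qed.

Lemma potential_excess_linear (u : R -> R -> R) (q t h : R) :
  potential_excess u q t h = 1 * u (q + h) t + (-1) * u q t + (- h) * partial1 u q t.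
Proof. unfold potential_excess. ring. Qed.

(** A perturbation independent of position changes the potential energy by zero on
    average. *)
Lemma potential_excess_mean (u : R -> R -> R) (t h : R) :
  class_C_2d 1 u -> periodic1 u -> RInt (fun q => potential_excess u q t h) 0 1 = 0.
Proof.
  intros Hu Hp. assert (Huc := C1_continuous u Hu). assert (HF := C1_partial1 u Hu).
  rewrite (RInt_ext _ (fun q => 1 * u (q + h) t + (-1) * u q t + (- h) * partial1 u q t))
    by (intros; apply potential_excess_linear).
  rewrite (RInt_linear3 (fun q => u (q + h) t) (fun q => u q t) (fun q => partial1 u q t)).
  - rewrite (RInt_period (fun q => u q t)); [|intros; now apply continuous2_1|intros; apply Hp].
    rewrite force_mean_zero by assumption.
    change (1 * RInt (fun q => u q t) 0 1 + -1 * RInt (fun q => u q t) 0 1 + - h * 0 = 0). ring.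
  - intros; now apply continuous_shift2.
  - intros; now apply continuous2_1.
  - intros; now apply continuous2_1.
Qed.

Lemma continuous2_force_gap (u : R -> R -> R) (c : R) :
  class_C_2d 2 u -> continuous2 (force_gap u c).
Proof.
  intros Hu. assert (HF := C1_continuous _ (C2_partial1_C1 u Hu)).
  apply continuous2_minus; [|exact HF].
  apply (continuous2_comp (partial1 u) (fun q _ => q + c) (fun _ t => t));
    [exact HF| |apply continuous2_snd].
  apply continuous2_plus; [apply continuous2_fst|apply continuous2_const].
Qed.

Lemma continuous_bump (R0 t p : R) : continuous (fun p => bump R0 p t) p.
Proof.
  apply (lipschitz_continuous _ 1); [lra|]. intros x y.
  eapply Rle_trans; [apply bump_lipschitz|]. eapply Rle_trans; [apply radius_lipschitz|].
  rewrite Rminus_diag, Rabs_R0. lra.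
Qed.

Lemma phase_variation_upper (u : R -> R -> R) (c s K R0 R1 B0 L0 B L P tau t : R) :
  class_C_2d 2 u -> periodic1 u -> 1 < R0 < R1 -> 0 <= s -> 0 < B0 -> 0 < L0 -> 0 < B ->
  s * L0 <= / 2 ->
  (forall q t, Rabs t <= R0 + 1 -> Rabs (partial1 u q t) <= B0) ->
  (forall x y t s, Rabs t <= R0 + 1 -> Rabs s <= R0 + 1 ->
    Rabs (partial1 u y s - partial1 u x t) <= L0 * (Rabs (y - x) + Rabs (s - t))) ->
  0 < tau -> tau * (1 + B) <= / 2 -> (forall q, Rabs (partial1 u q (t + tau)) <= B) ->
  RInt (fun q => partial1 u q (t + tau) ^ 2) 0 1 <= K ->
  0 < L -> variation_field R1 L (test_field u c s R0 R1) ->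
  Rabs t <= R1 -> Rabs (t + tau) <= R1 -> 0 <= P ->
  let C := ((2 * L0 * (R0 + 2) + 2 * B0 * (B0 + 1)) * (R0 + 1) ^ 2) ^ 2 in
  phase_integral P (variation u tau (test_field u c s R0 R1) t)
  <= tau * (16 * c ^ 2 * (1 + K) / (ln R1 - ln R0) ^ 2 * / (1 + Rabs t)
            + 2 * s ^ 2 * C * / (1 + Rabs t) ^ 2
            - / 2 * s * gap_energy u c t * RInt (fun p => bump R0 p t) (- P) P).
Proof.
  intros Hu Hpu HR Hs HB0 HL0 HB HsL HFB0 HFL0 Htau HtB HFB HK HL Hvf Ht Ht' HP C.
  assert (Hu1 := C2_C1 u Hu).
  assert (HF := C1_continuous _ (C2_partial1_C1 u Hu)).
  assert (HpF := periodic_partial1 u Hpu).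
  assert (HV := continuous2_variation u R1 L tau t _ Hu HL Hvf Ht Ht').
  assert (HC : 0 <= C) by apply pow2_ge_0.
  assert (HG := continuous2_force_gap u c Hu).
  assert (HG2 : continuous2 (fun q t => force_gap u c q t ^ 2)) by now apply continuous2_pow.
  assert (HF2 : continuous2 (fun q t => partial1 u q t ^ 2)) by now apply continuous2_pow.
  assert (Hln : ln R0 < ln R1) by (apply ln_increasing; lra).
  set (l := ln R1 - ln R0) in *. assert (Hl : 0 < l) by (unfold l; lra).
  set (a := 8 * c ^ 2 / l ^ 2).
  assert (Ha : 0 <= a).
  { apply Rmult_le_pos; [generalize (pow2_ge_0 c); lra|].
    left; apply Rinv_0_lt_compat, pow_lt; lra. }
  set (J := gap_energy u c t).
  set (wt := / (1 + Rabs t) ^ 2).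
  assert (Hinner : forall p, RInt (fun q => variation u tau (test_field u c s R0 R1) t q p) 0 1
    <= (tau * (a * (1 + K))) * / (1 + Rabs t + Rabs p) ^ 2
       + (tau * (s ^ 2 * C * wt)) * / (1 + Rabs p) ^ 2
       + (- (tau * (/ 2 * s * J))) * bump R0 p t).
  { intros p.
    (* for fixed [p] the pointwise bound is [k0 + k1 h1 - tau h2 + k3 h3] with [k]'s
       constant in [q] *)
    set (k1 := tau * (a * / radius p t ^ 2)).
    set (k0 := k1 + tau * (s ^ 2 * C * (/ (1 + Rabs p) ^ 2 * wt))).
    set (k3 := - (tau * (/ 2 * s * bump R0 p t))).
    set (g := c * log_cutoff R0 R1 p t).
    set (h1 := fun q => partial1 u (q + tau * p) (t + tau) ^ 2).
    set (h2 := fun q => potential_excess u q t g).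
    set (h3 := fun q => force_gap u c q t ^ 2).
    assert (C1 : forall q, continuous h1 q).
    { intros; unfold h1. now apply (continuous_shift2 (fun q t => partial1 u q t ^ 2)). }
    assert (C2 : forall q, continuous h2 q).
    { intros q; unfold h2.
      apply (continuous_ext
        (fun q => 1 * u (q + g) t + (-1) * u q t + (- g) * partial1 u q t)).
      { intros; symmetry; apply potential_excess_linear. }
      apply continuous_linear3.
      - apply continuous_shift2. now apply C1_continuous.
      - apply continuous2_1. now apply C1_continuous.
      - now apply continuous2_1. }
    assert (C3 : forall q, continuous h3 q).
    { intros; now apply (continuous2_1 (fun q t => force_gap u c q t ^ 2)). }
    assert (Hr := radius_ge_1 p t).
    assert (Hk1 : 0 <= k1).
    { apply Rmult_le_pos; [lra|]. apply Rmult_le_pos; [exact Ha|].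
      left; apply Rinv_0_lt_compat, pow_lt; lra. }
    apply Rle_trans with (RInt (fun q => 1 * k0 + 1 * (k1 * h1 q + - tau * h2 q + k3 * h3 q)) 0 1).
    { apply RInt_le_cont; [lra|intros; now apply continuous2_1| |].
      - intros. apply continuous_plus_R; [apply continuous_const|].
        apply continuous_scal_R. now apply continuous_linear3.
      - intros q _.
        assert (V := variation_test_upper u c s R0 R1 B0 L0 B tau t q p Hu1 HR Hs HB0 HL0 HB
          HsL HFB0 HFL0 Htau HtB HFB). cbv zeta in V. fold C l a in V.
        eapply Rle_trans; [exact V|]. right.
        unfold k0, k1, k3, h1, h2, h3, g, wt. ring. }
    rewrite (RInt_plus_R (fun _ => 1 * k0)
       (fun q => 1 * (k1 * h1 q + - tau * h2 q + k3 * h3 q))).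
    2:{ intros; apply continuous_const. }
    2:{ intros. apply continuous_scal_R. now apply continuous_linear3. }
    rewrite RInt_cst, RInt_scal_R by (intros; now apply continuous_linear3).
    rewrite RInt_linear3 by assumption.
    unfold h2 at 1. rewrite potential_excess_mean by assumption.
    assert (E1 : RInt h1 0 1 <= K).
    { unfold h1. rewrite (RInt_period (fun q => partial1 u q (t + tau) ^ 2)).
      - exact HK.
      - intros; now apply (continuous2_1 (fun q t => partial1 u q t ^ 2)).
      - intros; now rewrite HpF. }
    replace (RInt h3 0 1) with J by reflexivity.
    assert (E2 : k1 * RInt h1 0 1 <= k1 * K) by (apply Rmult_le_compat_l; assumption).
    replace (1 + Rabs t + Rabs p) with (radius p t) by (unfold radius; ring).
    replace (tau * (a * (1 + K)) * / radius p t ^ 2) with (k1 + k1 * K) by (unfold k1; ring).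
    unfold k0, k3. lra. }
  assert (Hat := Rabs_pos t).
  assert (D1 : forall p, continuous (fun p => / (1 + Rabs t + Rabs p) ^ 2) p)
    by (intros; apply continuous_inv_pow_abs; lra).
  assert (D2 : forall p, continuous (fun p => / (1 + Rabs p) ^ 2) p)
    by (intros; apply continuous_inv_pow_abs; lra).
  assert (D3 := continuous_bump R0 t).
  unfold phase_integral.
  apply Rle_trans with (RInt (fun p => (tau * (a * (1 + K))) * / (1 + Rabs t + Rabs p) ^ 2
       + (tau * (s ^ 2 * C * wt)) * / (1 + Rabs p) ^ 2
       + (- (tau * (/ 2 * s * J))) * bump R0 p t) (- P) P).
  { apply RInt_le_cont; [lra| | |].
    - intros; now apply continuous_RInt_parameter.
    - intros p. apply (continuous_linear3 (fun p => / (1 + Rabs t + Rabs p) ^ 2)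
         (fun p => / (1 + Rabs p) ^ 2) (fun p => bump R0 p t)); auto.
    - intros p _. apply Hinner. }
  rewrite (RInt_linear3 (fun p => / (1 + Rabs t + Rabs p) ^ 2)
         (fun p => / (1 + Rabs p) ^ 2) (fun p => bump R0 p t)) by auto.
  assert (I1 := RInt_inv_sqr_abs (1 + Rabs t) P ltac:(lra) HP).
  assert (I2 := RInt_inv_sqr_abs 1 P ltac:(lra) HP).
  assert (HK0 : 0 <= K).
  { eapply Rle_trans; [|exact HK]. apply RInt_nonneg; [lra| |intros; apply pow2_ge_0].
    intros; now apply (continuous2_1 (fun q t => partial1 u q t ^ 2)). }
  assert (W : 0 < wt) by (apply Rinv_0_lt_compat, pow_lt; lra).
  assert (M1 : tau * (a * (1 + K)) * RInt (fun p => / (1 + Rabs t + Rabs p) ^ 2) (- P) P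
     <= tau * (a * (1 + K)) * (2 / (1 + Rabs t))).
  { apply Rmult_le_compat_l; [|exact I1]. apply Rmult_le_pos; [lra|].
    apply Rmult_le_pos; lra. }
  assert (M2 : tau * (s ^ 2 * C * wt) * RInt (fun p => / (1 + Rabs p) ^ 2) (- P) P
     <= tau * (s ^ 2 * C * wt) * (2 / 1)).
  { apply Rmult_le_compat_l; [|exact I2]. apply Rmult_le_pos; [lra|].
    apply Rmult_le_pos; [|lra]. apply Rmult_le_pos; [apply pow2_ge_0|exact HC]. }
  replace (16 * c ^ 2 * (1 + K) / l ^ 2 * / (1 + Rabs t))
    with (a * (1 + K) * (2 / (1 + Rabs t))) by (unfold a; field; lra).
  lra.
Qed.

(** * Absence of shocks forces the force to vanish *)

(** A force that is constant in [q] would vanish, since its mean does. *)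
Lemma force_gap_nonzero (u : R -> R -> R) (q t : R) :
  class_C_2d 1 u -> periodic1 u -> partial1 u q t <> 0 ->
  exists c, force_gap u c q t <> 0.
Proof.
  intros Hu Hp Hq. apply not_all_not_ex. intros H. apply Hq.
  assert (E := force_mean_zero u t Hu Hp).
  rewrite (RInt_ext _ (fun _ => partial1 u q t)) in E.
  - rewrite RInt_cst in E. lra.
  - intros x _. specialize (H (x - q)). apply NNPP in H. unfold force_gap in H.
    replace (q + (x - q)) with x in H by ring.
    change (partial1 u x t = partial1 u q t). lra.
Qed.

Lemma gap_energy_positive (u : R -> R -> R) (c q t : R) :
  class_C_2d 2 u -> periodic1 u -> force_gap u c q t <> 0 -> 0 < gap_energy u c t.
Proof.
  intros Hu Hp Hq. apply (RInt_positive (fun q => force_gap u c q t ^ 2) q).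
  - intros; apply (continuous2_1 (fun q t => force_gap u c q t ^ 2)).
    apply continuous2_pow. now apply continuous2_force_gap.
  - intros; apply pow2_ge_0.
  - intros x. unfold force_gap. replace (x + 1 + c) with (x + c + 1) by ring.
    now rewrite !(periodic_partial1 u Hp).
  - apply pow2_gt_0, Hq.
Qed.

Lemma gap_energy_continuous (u : R -> R -> R) (c t : R) :
  class_C_2d 2 u -> continuous (gap_energy u c) t.
Proof.
  intros Hu. apply (continuous_RInt_parameter (fun q t => force_gap u c q t ^ 2)).
  apply continuous2_pow. now apply continuous2_force_gap.
Qed.

Lemma gap_energy_nonneg (u : R -> R -> R) (c t : R) :
  class_C_2d 2 u -> 0 <= gap_energy u c t.
Proof.
  intros Hu. apply RInt_nonneg; [lra| |intros; apply pow2_ge_0].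
  intros; apply (continuous2_1 (fun q t => force_gap u c q t ^ 2)).
  apply continuous2_pow. now apply continuous2_force_gap.
Qed.

(** With [R0 = |t0| + 4] the bump equals 1 for momenta of absolute value at
    most 1 and times within 1 of [t0]. *)
Lemma bump_integral (t0 t P : R) :
  1 <= P -> Rabs (t - t0) <= 1 -> 2 <= RInt (fun p => bump (Rabs t0 + 4) p t) (- P) P.
Proof.
  intros HP Ht.
  apply Rle_trans with (RInt (fun p => bump (Rabs t0 + 4) p t) (-1) 1).
  - apply Rle_trans with (RInt (fun _ => 1) (-1) 1).
    + right. symmetry. apply RInt_cst_eq. ring.
    + apply RInt_le_cont; [lra|intros; apply continuous_const|intros; apply continuous_bump|].
      intros p Hp. unfold bump, radius. rewrite clamp_1; [lra|].
      assert (Rabs p <= 1) by (apply Rabs_le_between; lra).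
      assert (Rabs t <= Rabs t0 + 1).
      { replace t with (t0 + (t - t0)) by ring. eapply Rle_trans; [apply Rabs_triang|]. lra. }
      lra.
  - apply RInt_restrict; try lra; [intros; apply continuous_bump|].
    intros; apply clamp_bounds.
Qed.

Lemma small_step (T e : R) : 0 < T -> 0 < e ->
  exists (N : nat) (tau : R), 0 < tau < e /\ INR N * tau = T.
Proof.
  intros HT He. destruct (nfloor_ex (T / e)) as [n Hn].
  { left. now apply Rdiv_lt_0_compat. }
  exists (S n), (T / INR (S n)).
  assert (Hp : 0 < INR (S n)) by (apply lt_0_INR; lia).
  split; [split|].
  - now apply Rdiv_lt_0_compat.
  - apply (Rmult_lt_reg_r (INR (S n))); [exact Hp|].
    replace (T / INR (S n) * INR (S n)) with T by (field; lra).
    rewrite S_INR. apply (Rmult_lt_reg_r (/ e)); [now apply Rinv_0_lt_compat|].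
    replace (e * (INR n + 1) * / e) with (INR n + 1) by (field; lra).
    unfold Rdiv in Hn. lra.
  - field. lra.
Qed.

(** The kinetic cost of the cutoff, of order [ln R1 / (ln R1)^2], is small for large
    [R1]. *)
Lemma large_radius (R0 D e : R) : 1 < R0 -> 0 <= D -> 0 < e ->
  exists R1, R0 < R1 /\ 4 * (D / (ln R1 - ln R0) ^ 2) * ln (1 + R1) <= e.
Proof.
  intros HR HD He.
  assert (Hl0 : 0 < ln R0) by (rewrite <- ln_1; apply ln_increasing; lra).
  assert (HDe : 0 <= 32 * D / e).
  { apply Rmult_le_pos; [lra|]. left; now apply Rinv_0_lt_compat. }
  set (X := 1 + 2 * ln R0 + 32 * D / e). assert (HX : 1 <= X) by (unfold X; lra).
  exists (exp X). split.
  - rewrite <- (exp_ln R0) by lra. apply exp_increasing. unfold X; lra.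
  - rewrite ln_exp.
    assert (H1 : ln (1 + exp X) <= 2 * X).
    { rewrite <- (ln_exp (2 * X)).
      assert (HE := exp_pos X). apply ln_le; [lra|].
      replace (2 * X) with (X + X) by ring. rewrite exp_plus.
      assert (1 + X <= exp X) by apply exp_ineq1_le. nra. }
    assert (H2 : X / 2 <= X - ln R0) by (unfold X; lra).
    assert (H3 : D / (X - ln R0) ^ 2 <= D / (X / 2) ^ 2).
    { apply Rmult_le_compat_l; [exact HD|]. apply Rinv_le_contravar.
      - apply pow_lt; lra.
      - apply pow_incr; lra. }
    assert (H4 : 0 <= D / (X - ln R0) ^ 2).
    { apply Rmult_le_pos; [exact HD|]. left. apply Rinv_0_lt_compat, pow_lt; lra. }
    assert (H5 : 0 <= ln (1 + exp X)).
    { rewrite <- ln_1. apply ln_le; [lra|]. generalize (exp_pos X); lra. }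
    apply Rle_trans with (4 * (D / (X / 2) ^ 2) * (2 * X)).
    { apply Rmult_le_compat; lra. }
    replace (4 * (D / (X / 2) ^ 2) * (2 * X)) with (32 * D / X) by (field; lra).
    apply (Rmult_le_reg_r X); [lra|].
    replace (32 * D / X * X) with (32 * D) by (field; lra).
    apply Rle_trans with (e * (32 * D / e)).
    { right. field. lra. }
    apply Rmult_le_compat_l; [lra|]. unfold X. lra.
Qed.

(** The three terms are the energy of the cutoff, the quadratic cost of the
    correction and its first-order gain, which is collected near time [t0]. *)
Lemma mean_variation_upper (u : R -> R -> R) (c s K R0 R1 B0 L0 B L P tau j d t0 : R) (N : nat) :
  class_C_2d 2 u -> periodic1 u -> R0 = Rabs t0 + 4 -> R0 < R1 -> 0 <= s ->
  0 < B0 -> 0 < L0 -> 0 < B -> s * L0 <= / 2 ->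
  (forall q t, Rabs t <= R0 + 1 -> Rabs (partial1 u q t) <= B0) ->
  (forall x y t s, Rabs t <= R0 + 1 -> Rabs s <= R0 + 1 ->
    Rabs (partial1 u y s - partial1 u x t) <= L0 * (Rabs (y - x) + Rabs (s - t))) ->
  (forall q t, Rabs t <= R1 -> Rabs (partial1 u q t) <= B) ->
  (forall t, RInt (fun q => partial1 u q t ^ 2) 0 1 <= K) ->
  0 < L -> variation_field R1 L (test_field u c s R0 R1) -> 1 <= P ->
  0 < j -> 0 < d <= 1 -> (forall t, Rabs (t - t0) < d -> j <= gap_energy u c t) ->
  0 < tau -> tau * (1 + B) <= / 2 -> tau <= d / 2 -> INR N * tau = R1 ->
  let C := ((2 * L0 * (R0 + 2) + 2 * B0 * (B0 + 1)) * (R0 + 1) ^ 2) ^ 2 in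
  sum_below (fun n => phase_integral P
     (variation u tau (test_field u c s R0 R1) (time R1 tau n))) (2 * N)
  <= 4 * (16 * c ^ 2 * (1 + K) / (ln R1 - ln R0) ^ 2) * ln (1 + R1)
     + 16 * s ^ 2 * C - / 2 * s * (j * d).
Proof.
  intros Hu Hpu HR0 HR Hs HB0 HL0 HB HsL HFB0 HFL0 HFB HK HL Hvf HP Hj Hd HJ Htau HtB Htd HN C.
  assert (At0 := Rabs_pos t0).
  assert (HC : 0 <= C) by apply pow2_ge_0.
  assert (HK0 : 0 <= K).
  { eapply Rle_trans; [|apply (HK 0)]. apply RInt_nonneg; [lra| |intros; apply pow2_ge_0].
    intros. apply (continuous2_1 (fun q t => partial1 u q t ^ 2)). apply continuous2_pow.
    apply C1_continuous. now apply C2_partial1_C1. }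
  set (A := 16 * c ^ 2 * (1 + K) / (ln R1 - ln R0) ^ 2).
  assert (HA : 0 <= A).
  { assert (ln R0 < ln R1) by (apply ln_increasing; lra).
    apply Rmult_le_pos.
    - apply Rmult_le_pos; [|lra]. generalize (pow2_ge_0 c); lra.
    - left. apply Rinv_0_lt_compat, pow_lt. lra. }
  set (I := fun t => gap_energy u c t * RInt (fun p => bump R0 p t) (- P) P).
  assert (HI : forall t, 0 <= I t).
  { intros t. apply Rmult_le_pos; [now apply gap_energy_nonneg|].
    apply RInt_nonneg; [lra|intros; apply continuous_bump|]. intros; apply clamp_bounds. }
  apply Rle_trans with (sum_below (fun n =>
      A * (tau * / (1 + Rabs (time R1 tau n)))
      + 2 * s ^ 2 * C * (tau * / (1 + Rabs (time R1 tau n)) ^ 2)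
      + (- (/ 2 * s)) * (tau * I (time R1 tau n))) (2 * N)).
  { apply sum_below_le. intros n Hn.
    assert (Ht := time_bound R1 tau N n Htau HN ltac:(lia)).
    assert (Ht' := time_bound R1 tau N (S n) Htau HN ltac:(lia)).
    rewrite time_S in Ht'.
    assert (V := phase_variation_upper u c s K R0 R1 B0 L0 B L P tau (time R1 tau n)
      Hu Hpu ltac:(lra) Hs HB0 HL0 HB HsL HFB0 HFL0 Htau HtB (fun q => HFB q _ Ht')
      (HK _) HL Hvf Ht Ht' ltac:(lra)).
    cbv zeta in V. fold C A in V. eapply Rle_trans; [exact V|]. right. unfold I. ring. }
  rewrite !sum_below_plus, (sum_below_scal A), (sum_below_scal (2 * s ^ 2 * C)),
    (sum_below_scal (- (/ 2 * s))).
  assert (S1 := sum_inv_time R1 tau N ltac:(lra) HN ltac:(lra)).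
  assert (S2 := sum_inv_sqr_time R1 tau N ltac:(lra) HN ltac:(lra)).
  assert (Htc : forall x, continuous (fun x => 2 * j * tent t0 d x) x).
  { intros. apply continuous_scal_R. apply tent_continuous. lra. }
  assert (S3 := sum_time_ge (fun x => 2 * j * tent t0 d x) I R1 tau N Htc HN Htau).
  rewrite RInt_scal_R in S3 by (intros; apply tent_continuous; lra).
  assert (Htent := tent_integral t0 d R1 Hd ltac:(lra)).
  assert (S3' : j * d <= sum_below (fun n => tau * I (time R1 tau n)) (2 * N)).
  { apply Rle_trans with (2 * j * RInt (tent t0 d) (- R1) R1).
    - replace (j * d) with (2 * j * (d / 2)) by field. apply Rmult_le_compat_l; lra.
    - apply S3. intros t x Hx. unfold tent.
      destruct (Rle_dec (d / 2) (Rabs (x - t0))) as [Hfar|Hnear].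
      + rewrite clamp_0; [rewrite Rmult_0_r; apply HI|].
        assert (4 / d * (d / 2) <= 4 / d * Rabs (x - t0)).
        { apply Rmult_le_compat_l; [|exact Hfar]. left; apply Rdiv_lt_0_compat; lra. }
        replace (4 / d * (d / 2)) with 2 in H by (field; lra). lra.
      + assert (Ht : Rabs (t - t0) < d).
        { apply Rnot_le_lt, Rabs_lt_between in Hnear. apply Rabs_lt_between. lra. }
        assert (K1 := HJ t Ht). assert (K2 := bump_integral t0 t P HP ltac:(lra)).
        rewrite <- HR0 in K2.
        assert (Hcl := clamp_bounds (2 - 4 / d * Rabs (x - t0))).
        apply Rle_trans with (j * 2); [nra|]. unfold I. apply Rmult_le_compat; lra. }
  assert (M1 := Rmult_le_compat_l A _ _ HA S1).
  assert (M2 := Rmult_le_compat_l (2 * s ^ 2 * C) _ _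
    ltac:(apply Rmult_le_pos; [generalize (pow2_ge_0 s); lra|exact HC]) S2).
  assert (M3 := Rmult_le_compat_l (/ 2 * s) _ _ ltac:(lra) S3').
  lra.
Qed.

(** The constants are chosen in the order [c], [R0], [s], [R1], [tau]: the gain
    does not depend on [R1], and the kinetic cost of the cutoff tends to 0 as [R1]
    tends to infinity. *)
Lemma global_solutions_zero_force (u : R -> R -> R) (K : R) :
  class_C_2d 2 u -> periodic1 u ->
  (forall t, RInt (fun q => partial1 u q t ^ 2) 0 1 <= K) ->
  (forall q p, exists f g, global_classical_solution (partial1 u) g f /\ f q 0 = p) ->
  forall q t, partial1 u q t = 0.
Proof.
  intros Hu Hpu HK Hcover q0 t0. apply NNPP. intros Hne.
  assert (HF := C2_partial1_C1 u Hu). assert (HpF := periodic_partial1 u Hpu).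
  destruct (force_gap_nonzero u q0 t0 (C2_C1 u Hu) Hpu Hne) as [c Hc].
  assert (HJ0 := gap_energy_positive u c q0 t0 Hu Hpu Hc).
  set (j := gap_energy u c t0 / 2). assert (Hj : 0 < j) by (unfold j; lra).
  destruct (proj1 (filterlim_locally (gap_energy u c) _)
    (gap_energy_continuous u c t0 Hu) (mkposreal j Hj)) as [d0 Hd0]. simpl in Hd0.
  set (d := Rmin d0 1).
  assert (Hd : 0 < d <= 1).
  { split; [apply Rmin_pos; [apply cond_pos|lra]|apply Rmin_r]. }
  assert (HJ : forall t, Rabs (t - t0) < d -> j <= gap_energy u c t).
  { intros t Ht. assert (Hb : ball t0 d0 t).
    { change (Rabs (t - t0) < d0). eapply Rlt_le_trans; [exact Ht|apply Rmin_l]. }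
    specialize (Hd0 t Hb). change (Rabs (gap_energy u c t - gap_energy u c t0) < j) in Hd0.
    apply Rabs_lt_between in Hd0. unfold j in *. lra. }
  remember (Rabs t0 + 4) as R0 eqn:HR0.
  assert (HR01 : 1 < R0) by (generalize (Rabs_pos t0); lra).
  destruct (strip_bounded (partial1 u) (R0 + 1) (C1_continuous _ HF) HpF) as [B0 [HB0 HFB0]].
  destruct (strip_lipschitz (partial1 u) (R0 + 1) HF HpF) as [L0 [HL0 HFL0]].
  set (C := ((2 * L0 * (R0 + 2) + 2 * B0 * (B0 + 1)) * (R0 + 1) ^ 2) ^ 2).
  assert (HC : 0 <= C) by apply pow2_ge_0.
  (* the linear gain s j d / 2 dominates the quadratic cost 16 s^2 C *)
  assert (Hjd : 0 < j * d) by (apply Rmult_lt_0_compat; lra).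
  set (s := Rmin (/ (2 * L0)) (j * d / (128 * (C + 1)))).
  assert (Hs : 0 < s).
  { apply Rmin_pos; [apply Rinv_0_lt_compat; lra|apply Rdiv_lt_0_compat; lra]. }
  assert (HsL : s * L0 <= / 2).
  { replace (/ 2) with (/ (2 * L0) * L0) by (field; lra).
    apply Rmult_le_compat_r; [lra|apply Rmin_l]. }
  assert (HsC : 16 * s ^ 2 * C <= s * (j * d) / 8).
  { assert (H1 : s * (128 * (C + 1)) <= j * d).
    { apply Rle_trans with (j * d / (128 * (C + 1)) * (128 * (C + 1))).
      - apply Rmult_le_compat_r; [lra|apply Rmin_r].
      - right; field; lra. }
    assert (H2 : s * (s * (128 * (C + 1))) <= s * (j * d)) by (apply Rmult_le_compat_l; lra).
    assert (0 <= s * s) by (apply Rmult_le_pos; lra). nra. }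
  assert (Hsjd : 0 < s * (j * d)) by (apply Rmult_lt_0_compat; lra).
  assert (HK0 : 0 <= K).
  { eapply Rle_trans; [|apply (HK 0)]. apply RInt_nonneg; [lra| |intros; apply pow2_ge_0].
    intros. apply (continuous2_1 (fun q t => partial1 u q t ^ 2)). apply continuous2_pow.
    now apply C1_continuous. }
  destruct (large_radius R0 (16 * c ^ 2 * (1 + K)) (s * (j * d) / 8) HR01) as [R1 [HR1 HR1']].
  { apply Rmult_le_pos; [|lra]. generalize (pow2_ge_0 c); lra. }
  { lra. }
  destruct (strip_bounded (partial1 u) R1 (C1_continuous _ HF) HpF) as [B [HB HFB]].
  destruct (test_field_variation_field u c s R0 R1 Hu Hpu (conj HR01 HR1) (Rlt_le _ _ Hs))
    as [L [HL Hvf]].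
  set (P := R1 + 3 * R1 * B).
  assert (HR1B : 0 < R1 * B) by (apply Rmult_lt_0_compat; lra).
  destruct (mean_variation_lower u R1 L R1 B P (s * (j * d) / 8) _ Hu Hpu Hcover
    ltac:(lra) HL Hvf (fun q p t => test_field_support u c s R0 R1 q p t (conj HR01 HR1))
    ltac:(lra) HB HFB ltac:(unfold P; lra) ltac:(lra)) as [d1 [Hd1 Hlow]].
  destruct (small_step R1 (Rmin d1 (Rmin (/ (2 * (1 + B))) (d / 2)))) as [N [tau [Htau HN]]].
  { lra. }
  { repeat apply Rmin_pos; try lra. apply Rinv_0_lt_compat; lra. }
  assert (T1 : tau < d1) by (eapply Rlt_le_trans; [apply Htau|apply Rmin_l]).
  assert (T2 : tau < Rmin (/ (2 * (1 + B))) (d / 2))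
    by (eapply Rlt_le_trans; [apply Htau|apply Rmin_r]).
  assert (T3 : tau <= / (2 * (1 + B))) by (left; eapply Rlt_le_trans; [apply T2|apply Rmin_l]).
  assert (T4 : tau <= d / 2) by (left; eapply Rlt_le_trans; [apply T2|apply Rmin_r]).
  assert (HtB : tau * (1 + B) <= / 2).
  { replace (/ 2) with (/ (2 * (1 + B)) * (1 + B)) by (field; lra).
    apply Rmult_le_compat_r; lra. }
  specialize (Hlow N tau ltac:(lra) HN).
  assert (Hup := mean_variation_upper u c s K R0 R1 B0 L0 B L P tau j d t0 N Hu Hpu HR0 HR1
    ltac:(lra) HB0 HL0 HB HsL HFB0 HFL0 HFB HK HL Hvf ltac:(unfold P; lra) Hj Hd HJ
    ltac:(lra) HtB T4 HN).
  cbv zeta in Hup. fold C in Hup. lra.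
Qed.

Theorem theorem1 (u : R -> R -> R) (K : R) (phi : R -> R -> R)
  (hu : class_C_2d 2 u)
  (hper : forall q t : R, u (q + 1) t = u q t)
  (hK : 0 < K)
  (hbound : forall t : R, RInt (fun q => (partial1 u q t) ^ 2) 0 1 < K)
  (hF : exists q t : R, partial1 u q t <> 0)
  (hphi : foliated_initial_data phi) :
  exists alpha : R, develops_shock (partial1 u) (phi alpha).
Proof.
  apply NNPP. intros Hno. destruct hF as [q0 [t0 Hne]]. apply Hne.
  apply (global_solutions_zero_force u K hu hper (fun t => Rlt_le _ _ (hbound t))).
  intros q p.
  destruct (proj2 (proj2 hphi) q) as [_ [k [_ [_ Hk]]]].
  assert (Hsol : exists f, global_classical_solution (partial1 u) (phi (k p)) f).
  { apply NNPP. intros H. apply Hno. now exists (k p). }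
  destruct Hsol as [f Hf]. exists f, (phi (k p)). split; [exact Hf|].
  rewrite (proj2 (proj2 (proj2 Hf)) q). apply Hk.
Qed.
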